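(* There is an algorithm that, given a finite metric space $(X,\mathrm{dist})$ with $|X|=n$, a positive integer $k$, an integer $n'$ with $1\le n'\le n$, and $\epsilon>0$, computes a set $X'\subseteq X$ together with a partition of $X'$ into $k$ clusters such that $|X'|\in[(1-\epsilon)n',\,n']$ and the total cost of this clustering of $X'$ is at most $O\!\left(\frac{1}{\epsilon^3}\right)\cdot \mathrm{opt}(X,n',k)$. The time complexity of this computation is $\mathrm{poly}(n,\log(1/\epsilon),\log\Delta)$, where $\Delta$ is the ratio of the largest to the smallest non-zero distance $\mathrm{dist}(x,y)$ between points of $X$.
   Context: For a finite set $Y\subseteq X$, its cost is $\mathrm{cost}(Y)=\frac12\sum_{x,y\in Y}\mathrm{dist}(x,y)$. A clustering of a set $X'$ into $k$ clusters is a partition of $X'$ into $k$ disjoint subsets $X_1,\dots,X_k$, with total cost $\sum_{i=1}^k\mathrm{cost}(X_i)$. The quantity $\mathrm{opt}(X,n',k)$ is the minimum total cost of a collection of $k$ disjoint subsets $X_1,\dots,X_k$ of $X$ with $\left|\bigcup_{i=1}^k X_i\right|\ge n'$. The constant hidden in $O(\cdot)$ is absolute. *)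

(* Defs.v *)
From HB Require Import structures.
From mathcomp Require Import all_boot all_order all_algebra.
From mathcomp Require Import boolp classical_sets reals exp.

Set Implicit Arguments.
Unset Strict Implicit.
Unset Printing Implicit Defensive.

Import Order.TTheory GRing.Theory Num.Theory.
Local Open Scope ring_scope.

(* * Min-sum clustering *)

Definition is_metric (R : realType) (X : finType) (dist : X -> X -> R) : Prop :=
  [/\ forall x y, 0 <= dist x y,
      forall x y, dist x y = 0 <-> x = y,
      forall x y, dist x y = dist y x
    & forall x y z, dist x z <= dist x y + dist y z].

Definition cost (R : realType) (X : finType) (dist : X -> X -> R)
    (Y : {set X}) : R :=
  2^-1 * \sum_(x in Y) \sum_(y in Y) dist x y.

Definition total_cost (R : realType) (X : finType) (dist : X -> X -> R)
    (k : nat) (F : 'I_k -> {set X}) : R :=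
  \sum_(i < k) cost dist (F i).

Definition disjoint_family (X : finType) (k : nat) (F : 'I_k -> {set X}) : Prop :=
  forall i j : 'I_k, i != j -> [disjoint F i & F j].

Definition union_family (X : finType) (k : nat) (F : 'I_k -> {set X}) : {set X} :=
  (\bigcup_(i < k) F i)%SET.

(* Clusters may be empty (k is not assumed to be at most the number of points). *)
Definition is_clustering (X : finType) (k : nat) (X' : {set X})
    (F : 'I_k -> {set X}) : Prop :=
  disjoint_family F /\ union_family F = X'.

Definition opt_values (R : realType) (X : finType) (dist : X -> X -> R)
    (n' k : nat) : set R :=
  (fun c : R => exists F : 'I_k -> {set X},
     [/\ disjoint_family F, (n' <= #|union_family F|)%N
       & c = total_cost dist F]).

(* When 0 < k and n' <= #|X| this infimum is a minimum: see [opt_is_min]. *)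
Definition opt (R : realType) (X : finType) (dist : X -> X -> R)
    (n' k : nat) : R :=
  inf (opt_values dist n' k).

(* The aspect ratio Delta. A one-point space has no non-zero distance; there   *)
(* the ratio is 0 / 0 = 0, and its logarithm below is ln 0 = 0.                *)
Definition aspect_ratio (R : realType) (X : finType) (dist : X -> X -> R) : R :=
  sup (fun r : R => exists x y, dist x y != 0 /\ r = dist x y) /
  inf (fun r : R => exists x y, dist x y != 0 /\ r = dist x y).

(* * Real RAM                                                                 *)
(* Programs manipulate integer and real arrays with two indices, addressed by *)
(* a static name and dynamically computed indices. Real operations are exact  *)
(* field operations and comparisons. To rule out the well-known abuses of     *)
(* unit-cost arithmetic there is neither a conversion from reals to integers  *)
(* (no rounding) nor an integer multiplication, and the only constants in a   *)
(* program are natural numbers.                                               *)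

Inductive nexp : Type :=
| NConst of nat
| NGet of nat & nexp & nexp
| NAdd of nexp & nexp
| NSub of nexp & nexp.

Inductive rexp : Type :=
| RNat of nexp
| RGet of nat & nexp & nexp
| RAdd of rexp & rexp
| RSub of rexp & rexp
| RMul of rexp & rexp
| RDiv of rexp & rexp.

Inductive bexp : Type :=
| BNle of nexp & nexp
| BRle of rexp & rexp
| BNot of bexp
| BAnd of bexp & bexp.

Inductive program : Type :=
| Skip
| NSet of nat & nexp & nexp & nexp
| RSet of nat & nexp & nexp & rexp
| Seq of program & program
| If of bexp & program & program
| While of bexp & program.

Record state (R : realType) : Type := State {
  nmem : nat -> nat -> nat -> nat;
  rmem : nat -> nat -> nat -> R
}.

Definition upd (T : Type) (m : nat -> nat -> nat -> T) (a i j : nat) (v : T) :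
    nat -> nat -> nat -> T :=
  fun a' i' j' => if [&& a' == a, i' == i & j' == j] then v else m a' i' j'.

Fixpoint neval (R : realType) (s : state R) (e : nexp) : nat :=
  match e with
  | NConst n => n
  | NGet a i j => nmem s a (neval s i) (neval s j)
  | NAdd e1 e2 => (neval s e1 + neval s e2)%N
  | NSub e1 e2 => (neval s e1 - neval s e2)%N
  end.

Fixpoint reval (R : realType) (s : state R) (e : rexp) : R :=
  match e with
  | RNat e1 => (neval s e1)%:R
  | RGet a i j => rmem s a (neval s i) (neval s j)
  | RAdd e1 e2 => reval s e1 + reval s e2
  | RSub e1 e2 => reval s e1 - reval s e2
  | RMul e1 e2 => reval s e1 * reval s e2
  | RDiv e1 e2 => reval s e1 / reval s e2
  end.

Fixpoint beval (R : realType) (s : state R) (b : bexp) : bool :=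
  match b with
  | BNle e1 e2 => (neval s e1 <= neval s e2)%N
  | BRle e1 e2 => reval s e1 <= reval s e2
  | BNot b1 => ~~ beval s b1
  | BAnd b1 b2 => beval s b1 && beval s b2
  end.

Definition nset (R : realType) (s : state R) (a i j v : nat) : state R :=
  State (upd (nmem s) a i j v) (rmem s).

Definition rset (R : realType) (s : state R) (a i j : nat) (v : R) : state R :=
  State (nmem s) (upd (rmem s) a i j v).

(* [exec p s s' t]: p started in s halts in s' after t steps. Assignments and *)
(* tests count for one step each: the expressions of a program have constant  *)
(* size, so charging for each operation would only change t by a constant     *)
(* factor.                                                                    *)
Inductive exec (R : realType) : program -> state R -> state R -> nat -> Prop :=
| ExecSkip s : exec Skip s s 1
| ExecNSet a i j e s :
    exec (NSet a i j e) s (nset s a (neval s i) (neval s j) (neval s e)) 1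
| ExecRSet a i j e s :
    exec (RSet a i j e) s (rset s a (neval s i) (neval s j) (reval s e)) 1
| ExecSeq p1 p2 s1 s2 s3 t1 t2 :
    exec p1 s1 s2 t1 -> exec p2 s2 s3 t2 -> exec (Seq p1 p2) s1 s3 (t1 + t2)
| ExecIfTrue b p1 p2 s s' t :
    beval s b -> exec p1 s s' t -> exec (If b p1 p2) s s' t.+1
| ExecIfFalse b p1 p2 s s' t :
    ~~ beval s b -> exec p2 s s' t -> exec (If b p1 p2) s s' t.+1
| ExecWhileFalse b p s :
    ~~ beval s b -> exec (While b p) s s 1
| ExecWhileTrue b p s1 s2 s3 t1 t2 :
    beval s1 b -> exec p s1 s2 t1 -> exec (While b p) s2 s3 t2 ->
    exec (While b p) s1 s3 (t1 + t2).+1.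

(* * Input and output conventions                                             *)
(* Points are numbered by [enum_rank]. Initially integer array 0 contains     *)
(* n, k, n' at (0,0), (1,0), (2,0); real array 0 contains the distance matrix,*)
(* and real array 1 contains epsilon at (0,0); every other cell is 0.         *)

Definition dist_matrix (R : realType) (X : finType) (dist : X -> X -> R)
    (i j : nat) : R :=
  match insub i : option 'I_#|X|, insub j : option 'I_#|X| with
  | Some i', Some j' => dist (enum_val i') (enum_val j')
  | _, _ => 0
  end.

Definition input_state (R : realType) (X : finType) (dist : X -> X -> R)
    (k n' : nat) (eps : R) : state R :=
  State
    (fun a i j => match a, i, j with
                  | 0, 0, 0 => #|X|
                  | 0, 1, 0 => k
                  | 0, 2, 0 => n'
                  | _, _, _ => 0
                  end%N)
    (fun a i j => match a, i, j with
                  | 0%N, _, _ => dist_matrix dist i j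
                  | 1%N, 0%N, 0%N => eps
                  | _, _, _ => 0
                  end).

(* On halting, cell (i,0) of integer array 1 contains 0 if the i-th point is  *)
(* left out, and c + 1 if it belongs to the cluster number c < k.             *)

Definition out_label (R : realType) (X : finType) (s : state R) (x : X) : nat :=
  nmem s 1 (enum_rank x) 0.

Definition out_points (R : realType) (X : finType) (s : state R) : {set X} :=
  [set x : X | out_label s x != 0%N]%SET.

Definition out_clusters (R : realType) (X : finType) (s : state R) (k : nat)
    (c : 'I_k) : {set X} :=
  [set x : X | out_label s x == c.+1]%SET.

(* A bound B is poly(n, log(1/eps), log Delta) when it is at most             *)
(* a * (poly_base ...) ^+ b for constants a and b; log(1/eps) is read as 0    *)
(* when eps > 1.                                                              *)
Definition poly_base (R : realType) (X : finType) (dist : X -> X -> R)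
    (eps : R) : R :=
  1 + #|X|%:R + Num.max 0 (ln (eps^-1)) + ln (aspect_ratio dist).

(* * Sanity checks *)

Lemma exec_det (R : realType) p (s s1 s2 : state R) t1 t2 :
  exec p s s1 t1 -> exec p s s2 t2 -> s1 = s2 /\ t1 = t2.
Proof.
move=> H; elim: H s2 t2 => {p s s1 t1}; intros;
  match goal with H : exec _ _ _ _ |- _ => inversion H; subst; clear H end;
  repeat match goal with
  | Hp : is_true ?b, Hn : is_true (~~ ?b) |- _ => by rewrite Hp in Hn
  | IH : forall _ _, exec ?p ?s _ _ -> _, H : exec ?p ?s _ _ |- _ =>
      have [? ?] := IH _ _ H; subst; clear H
  end; by split.
Qed.

Lemma opt_is_min (R : realType) (X : finType) (dist : X -> X -> R) (n' k : nat) :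
  (0 < k)%N -> (n' <= #|X|)%N ->
  opt_values dist n' k (opt dist n' k) /\
  forall c, opt_values dist n' k c -> opt dist n' k <= c.
Proof.
move=> k_gt0 le_n'.
pose P (F : {ffun 'I_k -> {set X}}) :=
  [forall i, forall j, (i != j) ==> [disjoint F i & F j]] &&
  (n' <= #|union_family F|)%N.
have PE (F : {ffun 'I_k -> {set X}}) :
    P F <-> (disjoint_family F /\ (n' <= #|union_family F|)%N).
  split.
    case/andP=> /forallP H ->; split=> // i j.
    by have /forallP/(_ j)/implyP := H i.
  case=> H Hn; rewrite /P Hn andbT; apply/forallP=> i; apply/forallP=> j.
  by apply/implyP; apply: H.
pose i0 := Ordinal k_gt0.
pose F0 : {ffun 'I_k -> {set X}} :=
  [ffun i => if i == i0 then [set: X]%SET else finset.set0].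
have PF0 : P F0.
  apply/PE; split.
    move=> i j; rewrite !ffunE; case: (eqVneq i i0) => [->|_ _]; last first.
      by rewrite -finset.setI_eq0 finset.set0I.
    by rewrite eq_sym => /negPf ->; rewrite -finset.setI_eq0 finset.setI0.
  suff -> : union_family F0 = [set: X]%SET by rewrite cardsT.
  apply/eqP; rewrite -finset.subTset; apply/fintype.subsetP=> x _.
  by apply/bigcupP; exists i0 => //; rewrite ffunE eqxx inE.
have [F PF minF] := @arg_minP _ R _ F0 P (fun F => total_cost dist F) PF0.
have lbF c : opt_values dist n' k c -> total_cost dist F <= c.
  move=> [G [dG nG ->]].
  have eqG : finfun G = G :> ('I_k -> {set X}) by apply: funext => i; rewrite ffunE.
  by have := minF (finfun G); rewrite eqG; apply; apply/PE; rewrite eqG.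
have vF : opt_values dist n' k (total_cost dist F).
  by move/PE: PF => [dF nF]; exists F.
suff -> : opt dist n' k = total_cost dist F by [].
apply/eqP; rewrite eq_le; apply/andP; split.
  by apply: ge_inf => //; exists (total_cost dist F) => c; apply: lbF.
by apply: lb_le_inf; [exists (total_cost dist F)|move=> c; apply: lbF].
Qed.

(* Main.v *)
From mathcomp Require Import all_boot all_order all_algebra.
From mathcomp Require Import ring lra zify.
From mathcomp Require Import boolp classical_sets reals exp.
Require Import Defs.

(* Fix a scale lambda, and call a set T valid if, for some center c, every      *)
(* point of T is at distance at most lambda / |T|^2 from c; such a cluster      *)
(* costs at most lambda. Raise the price of all points uniformly, and freeze    *)
(* the price of the points of a valid set as soon as its total price is 1. A    *)
(* tight set that meets no earlier core becomes a core; otherwise the points it *)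
(* freezes join the pool of a core it meets. A pool point with price beta is at *)
(* distance at most 3 lambda beta^2 from the center of its core. Each pool is   *)
(* cut into bins of mass at least 1 and less than 2, the remainder going to the *)
(* core, so that every cluster has mass at least 1. Dropping from a cluster of  *)
(* size s the pool points of price above 1 / (delta s) loses a fraction         *)
(* 2 delta of it and bounds its cost by O(lambda / delta).                      *)
(*                                                                              *)
(* Around its best center, an optimal cluster loses a fraction delta of its     *)
(* points when restricted to a ball of 1 / delta times the average radius; if   *)
(* lambda = 8 opt / (delta^2 k), the balls split into at most (1 + delta) k     *)
(* valid sets, so that the optimum has total price at most (1 + delta) k. The   *)
(* frozen points are the cheapest ones, so their mass is less than k as long as *)
(* fewer than (1 - 4 delta) n' are frozen, and there are at most k clusters.    *)
(*                                                                              *)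
(* Only the values m^2 dist z c of lambda matter: trying them all makes the     *)
(* running time polynomial in n alone.                                          *)

Set Implicit Arguments.
Unset Strict Implicit.
Unset Printing Implicit Defensive.

Import Order.TTheory GRing.Theory Num.Theory.
Local Open Scope ring_scope.

(** * Prices and the optimum *)

(** For a scale [lam], covering points by [valid] sets is a linear program, and a [packing_price] is
    a feasible solution of its dual. The clustering and the optimum are compared only through such
    prices.

    Upper bound on prices. By [near_part] and [near_mass], the part of an optimal cluster near its
    best center has price at most 1 + 8 cost / (delta lam). With lam = 8 opt / (delta^2 k), at least
    (1 - delta) n' points of the optimum then have total price at most (1 + delta) k, whatever the
    feasible price. This property is [adequate]; [exists_adequate] finds it at a scale of the form
    m^2 dist z c.

    Lower bound. The dual ascent builds a feasible price: [feasible_of_candidates] reduces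
    feasibility over all valid sets to cubically many candidates, and [dual_step] maintains the
    invariant. Trimming makes each one cheap ([cluster_cost]) and loses few points ([cluster_drop]);
    [labels_good] combines the two. With delta = eps / 8, a cluster costs at most 56 lam / eps, and
    lam k is O(opt / eps^2), whence the cube of 1 / eps.

    Computation. Every program whose loops all have length n is polynomial ([exec_compile],
    [time_bound_poly]). The program tries all scales and keeps the smallest one that gives at most k
    clusters; it is at most the adequate one ([min_sum_algorithmP], [min_sum_algorithm_good]). *)

Section MinSum.
Variables (R : realType) (X : finType) (dist : X -> X -> R).
Hypothesis dist_metric : is_metric dist.

Let dist_ge0 x y : 0 <= dist x y. Proof. by case: dist_metric. Qed.
Let dist_xx x : dist x x = 0.
Proof. by case: dist_metric => _ H _ _; apply/H. Qed.
Let distC x y : dist x y = dist y x. Proof. by case: dist_metric. Qed.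
Let dist_tri x y z : dist x z <= dist x y + dist y z.
Proof. by case: dist_metric. Qed.

Lemma cost_ge0 (Y : {set X}) : 0 <= cost dist Y.
Proof.
by rewrite mulr_ge0 ?invr_ge0 //; apply: sumr_ge0 => x _; apply: sumr_ge0.
Qed.

Lemma cost_le_star (Y : {set X}) (c : X) :
  cost dist Y <= #|Y|%:R * \sum_(x in Y) dist c x.
Proof.
rewrite /cost mulrC ler_pdivrMr ?ltr0n //.
apply: (@le_trans _ _ (\sum_(x in Y) \sum_(y in Y) (dist c x + dist c y))).
  by apply: ler_sum => x _; apply: ler_sum => y _; rewrite (distC c x) dist_tri.
rewrite (eq_bigr (fun x => #|Y|%:R * dist c x + \sum_(y in Y) dist c y)); last first.
  by move=> x _; rewrite big_split /= sumr_const mulr_natl.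
by rewrite big_split /= -mulr_sumr sumr_const -[X in _ + X <= _]mulr_natl; lra.
Qed.

(** Summed over all centers in [Y], the star sums give twice the cost, so the best center does at
    least as well as the average one. *)
Lemma star_le_cost (Y : {set X}) : Y != finset.set0 ->
  exists c, #|Y|%:R * \sum_(x in Y) dist c x <= 2 * cost dist Y.
Proof.
case/set0Pn=> y0 Yy0.
have [c Yc minc] := @arg_minP _ R _ y0 (mem Y) (fun c => \sum_(x in Y) dist c x) Yy0.
exists c; rewrite /cost mulrA divff ?pnatr_eq0 // mul1r.
rewrite mulr_natl -sumr_const; exact: ler_sum.
Qed.

Definition valid (lam : R) (T : {set X}) : Prop :=
  exists c, forall x, x \in T -> #|T|%:R ^+ 2 * dist c x <= lam.

(** The dual of fractional covering by valid sets: by weak duality, the total price of a set is a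
    lower bound on the number of valid sets that cover it. *)
Definition packing_price (lam : R) (p : X -> R) : Prop :=
  (forall x, 0 <= p x) /\ forall T, valid lam T -> \sum_(x in T) p x <= 1.

(* Markov's inequality around the best center. *)
Lemma near_part (O : {set X}) (delta : R) : 0 < delta -> O != finset.set0 ->
  exists c (A : {set X}), [/\ A \subset O, (1 - delta) * #|O|%:R <= #|A|%:R &
    forall x, x \in A -> #|O|%:R ^+ 2 * dist c x <= 2 * cost dist O / delta].
Proof.
move=> d0 O0; have [c hc] := star_le_cost O0.
set D := 2 * cost dist O in hc *; set m : R := #|O|%:R in hc *.
have m0 : 0 < m by rewrite /m ltr0n card_gt0.
exists c, [set x in O | m ^+ 2 * dist c x <= D / delta]%SET.
split; last by move=> x; rewrite inE => /andP[].
  by apply/fintype.subsetP => x; rewrite inE => /andP[].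
set A := [set x in O | _]%SET.
have sAO : A \subset O by apply/fintype.subsetP => x; rewrite inE => /andP[].
have cardm : m = #|A|%:R + #|O :\: A|%:R :> R.
  by rewrite /m -natrD -(cardsID A O) (finset.setIidPr sAO).
suff: #|O :\: A|%:R <= delta * m by move: cardm; lra.
have D0 : 0 <= D by rewrite mulr_ge0 ?cost_ge0.
have [E|/set0Pn[x0 x0P]] := eqVneq (O :\: A) finset.set0.
  by rewrite E cards0 mulr_ge0 ?ltW.
have far x : x \in O :\: A -> D / delta < m ^+ 2 * dist c x.
  by rewrite !inE => /andP[+ xO]; rewrite xO /= -ltNge.
have sfar : \sum_(x in O :\: A) dist c x <= \sum_(x in O) dist c x.
  rewrite [leRHS](big_setID A) /= ler_wpDl //; exact: sumr_ge0.
(* If [D] were 0, all distances from [c] within [O] would vanish, against the positive distance of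
   the far point [x0]. *)
have Dp : 0 < D.
  rewrite lt_neqAle D0 andbT; apply/eqP => D0'.
  have := far _ x0P; rewrite -D0' mul0r.
  have : \sum_(x in O :\: A) dist c x <= 0.
    by apply: le_trans sfar _; rewrite -(ler_pM2l m0) mulr0 [leRHS]D0'.
  rewrite (bigD1 x0) //=.
  have : 0 <= \sum_(i in O :\: A | i != x0) dist c i by apply: sumr_ge0.
  move=> h1 h2 h3; have := dist_ge0 c x0; nra.
have : #|O :\: A|%:R * (D / delta) <= m ^+ 2 * \sum_(x in O :\: A) dist c x.
  rewrite mulr_natl -sumr_const mulr_sumr; apply: ler_sum => x xf.
  by apply/ltW/far.
move=> h.
have h2 : #|O :\: A|%:R * (D / delta) <= m * D.
  apply: le_trans h _; rewrite expr2 -mulrA ler_pM2l //.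
  by apply: le_trans hc; rewrite ler_pM2l.
rewrite -(ler_pM2r (divr_gt0 Dp d0)); apply: le_trans h2 _.
suff -> : delta * m * (D / delta) = m * D by [].
by field; rewrite gt_eqF.
Qed.

(** Cut [A] into at most |A| / q + 1 pieces of size at most q; each has price at most 1. *)
Lemma sum_chunks (p : X -> R) (q : nat) (A : {set X}) : (0 < q)%N ->
  (forall S : {set X}, S \subset A -> (#|S| <= q)%N -> \sum_(x in S) p x <= 1) ->
  q%:R * \sum_(x in A) p x <= #|A|%:R + q%:R.
Proof.
move=> q0; have [b] := ubnP #|A|; elim: b A => // b IH A ltA H.
have [le|lt] := leqP #|A| q.
  have := H A (subxx _) le; have := ler0n R q; have := ler0n R #|A|; nra.
have [S sSA cS] : exists2 S : {set X}, S \subset A & #|S| = q.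
  exists [set x in take q (enum A)]%SET.
    by apply/fintype.subsetP => x; rewrite inE => /mem_take; rewrite mem_enum.
  rewrite cardsE; have /card_uniqP -> : uniq (take q (enum A)).
    by rewrite take_uniq ?enum_uniq.
  by rewrite size_take -cardE lt.
have cA : #|A| = (q + #|A :\: S|)%N by have := cardsID S A; rewrite (finset.setIidPr sSA) cS => ->.
rewrite (big_setID S) /= (finset.setIidPr sSA); have := IH (A :\: S).
have := H S sSA; rewrite cS leqnn => /(_ isT) h1.
have -> : (#|A :\: S| < b)%N by lia.
move=> /(_ isT); have HS (U : {set X}) : U \subset A :\: S -> (#|U| <= q)%N -> \sum_(x in U) p x <= 1.
  by move=> sU; apply: H; apply: fintype.subset_trans sU (subsetDl _ _).
move=> /(_ HS); rewrite cA natrD mulrDr => h2; have := ler0n R q; nra.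
Qed.

(** A subset of [A] with q points is valid around [c] as soon as q^2 D <= lam m^2. For the largest
    such q, [sum_chunks] bounds the price by m / q + 1, and maximality gives lam m / q <= 4 D q / m
    <= 4 D. *)
Lemma near_mass (lam D : R) (p : X -> R) (c : X) (A : {set X}) (m : nat) :
  0 <= lam -> 0 <= D -> packing_price lam p -> (0 < m)%N -> (#|A| <= m)%N ->
  (forall x, x \in A -> m%:R ^+ 2 * dist c x <= D) ->
  lam * \sum_(x in A) p x <= lam + 4 * D /\ (D <= lam -> \sum_(x in A) p x <= 1).
Proof.
move=> lam0 D0 [p0 feas] m0 leAm HA.
have m0' : 0 < m%:R :> R by rewrite ltr0n.
have DA1 : D <= lam -> \sum_(x in A) p x <= 1.
  move=> leD; apply: feas; exists c => x xA; apply: le_trans leD.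
  apply: le_trans (HA x xA); apply: ler_wpM2r => //.
  by rewrite lerXn2r ?nnegrE ?ler0n // ler_nat.
split=> //.
have [leD|ltD] := leP D lam; first by have := DA1 leD; nra.
(* [P q] makes every subset of [A] with at most q points valid with center [c]. *)
pose P (q : nat) := q%:R ^+ 2 * D <= lam * m%:R ^+ 2.
have ex : exists q, P q by exists 0%N; rewrite /P expr0n mul0r mulr_ge0 // exprn_ge0 // ltW.
have ub q : P q -> (q <= m)%N.
  rewrite /P; apply: contraTT; rewrite -ltnNge -ltNge => ltq.
  have : m%:R < q%:R :> R by rewrite ltr_nat.
  move=> h; apply: le_lt_trans (_ : D * m%:R ^+ 2 < _).
    by apply: ler_wpM2r; rewrite ?exprn_ge0 ?ltW.
  have Dp : 0 < D by apply: le_lt_trans ltD.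
  by rewrite mulrC ltr_pM2r // ltr_pXn2r ?nnegrE ?ler0n.
have [q0 Pq0 maxq] := ex_maxnP ex ub.
(* When [q0] is 0 the chunks are singletons, which are valid around themselves. In both cases q0 + 1
   <= 2 q, the source of the factor 4. *)
pose q := maxn q0 1.
have q_gt0 : (0 < q)%N by rewrite /q leq_max orbT.
have q_le : (q <= m)%N by rewrite geq_max ub.
have big : lam * m%:R ^+ 2 < 4 * q%:R ^+ 2 * D.
  have : ~~ P q0.+1 by apply/negP => /maxq; rewrite ltnn.
  rewrite /P -ltNge => h; apply: lt_le_trans h _.
  rewrite (_ : 4 * q%:R ^+ 2 = (2 * q%:R) ^+ 2); last by ring.
  apply: ler_wpM2r => //; rewrite lerXn2r ?nnegrE ?ler0n ?mulr_ge0 //.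
  rewrite -natrM ler_nat /q; lia.
have Hch (S : {set X}) : S \subset A -> (#|S| <= q)%N -> \sum_(x in S) p x <= 1.
  move=> sSA leS; have [E|/set0Pn[s sS]] := eqVneq S finset.set0.
    by rewrite E big_set0 ler01.
  apply: feas; have [le1|lt1] := leqP q0 0.
    have /cards1P[y ->] : #|S| == 1%N.
      by rewrite eqn_leq card_gt0 (leq_trans leS) /=; [apply/set0Pn; exists s|rewrite /q; lia].
    by exists y => x; rewrite inE => /eqP ->; rewrite dist_xx mulr0.
  have leS0 : (#|S| <= q0)%N by move: leS; rewrite /q; lia.
  exists c => x xS; have h := HA x (fintype.subsetP sSA x xS).
  rewrite -(@ler_pM2r _ (m%:R ^+ 2)) ?exprn_gt0 //.
  apply: le_trans Pq0; rewrite -mulrA (mulrC (dist c x)).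
  apply: ler_pM => //; rewrite ?exprn_ge0 ?mulr_ge0 ?exprn_ge0 ?ler0n //.
  by rewrite lerXn2r ?nnegrE ?ler0n // ler_nat.
have := sum_chunks q_gt0 Hch.
set S := \sum_(x in A) p x.
have q0' : 0 < q%:R :> R by rewrite ltr0n.
have q1 : q%:R <= m%:R :> R by rewrite ler_nat.
have am : #|A|%:R <= m%:R :> R by rewrite ler_nat.
move=> h.
have h1 : lam * m%:R <= 4 * D * q%:R.
  rewrite -(ler_pM2r m0') -(ler_pM2r q0').
  have -> : lam * m%:R * m%:R * q%:R = lam * m%:R ^+ 2 * q%:R by ring.
  have -> : 4 * D * q%:R * m%:R * q%:R = (4 * q%:R ^+ 2 * D) * m%:R by ring.
  by apply: ler_pM => //; rewrite ?mulr_ge0 ?exprn_ge0 // ltW.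
rewrite -(ler_pM2r q0').
have -> : lam * S * q%:R = lam * (q%:R * S) by ring.
apply: le_trans (_ : lam * (m%:R + q%:R) <= _); first by apply: ler_wpM2l => //; lra.
lra.
Qed.

(** Dual form of the statement that about (1 + delta) k valid sets fractionally cover almost n'
    points. Quantifying over prices avoids any appeal to linear programming duality. *)
Definition adequate (k n' : nat) (delta lam : R) : Prop :=
  exists Z : {set X}, (1 - delta) * n'%:R <= #|Z|%:R /\
    forall p, packing_price lam p -> \sum_(x in Z) p x <= (1 + delta) * k%:R.

(** At the ideal scale [lams] = 8 opt / (delta^2 k), summing [near_mass] over the optimal clusters
    gives k + 8 opt / (delta lams) = (1 + delta) k. Validity only compares the scale with numbers of
    the form m^2 dist z c, so rounding [lams] down to the largest of them preserves the valid
    sets. *)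
Lemma exists_adequate (k n' : nat) (delta : R) :
  (0 < k)%N -> (0 < n' <= #|X|)%N -> 0 < delta ->
  exists m (z c : X), [/\ (m < #|X|)%N,
    adequate k n' delta (m.+1%:R ^+ 2 * dist z c) &
    m.+1%:R ^+ 2 * dist z c * (delta ^+ 2 * k%:R) <= 8 * opt dist n' k].
Proof.
move=> k0 /andP[n0 le_n] d0.
have [[O [dO nO optE]] _] := opt_is_min dist k0 le_n.
rewrite optE; set opt0 := total_cost _ _.
have k0' : 0 < k%:R :> R by rewrite ltr0n.
have opt_ge0 : 0 <= opt0 by apply: sumr_ge0 => i _; apply: cost_ge0.
have [x0 _] : exists x0 : X, true.
  by have /card_gt0P[x _] := leq_trans n0 le_n; exists x.
have [d1|d1] := leP delta 1; last first.
  (* For delta > 1 the size requirement is negative: the empty set and the scale 0 suffice. *)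
  exists 0%N, x0, x0; rewrite dist_xx mulr0 mul0r mulr_ge0 //.
  split=> //; first exact: leq_trans n0 le_n.
  exists finset.set0; rewrite cards0; split=> [|p _].
    by rewrite mulr_le0_ge0 // subr_le0 ltW.
  by rewrite big_set0 mulr_ge0 // ltW // addr_gt0.
pose lams := 8 * opt0 / (delta ^+ 2 * k%:R).
have dk : 0 < delta ^+ 2 * k%:R by rewrite mulr_gt0 ?exprn_gt0.
have lams0 : 0 <= lams by rewrite divr_ge0 ?mulr_ge0 // ltW.
pose f (u : 'I_#|X| * X * X) := (u.1.1).+1%:R ^+ 2 * dist u.1.2 u.2.
have i0 : 'I_#|X| by exact: Ordinal (leq_trans n0 le_n).
have Pu0 : f (i0, x0, x0) <= lams by rewrite /f /= dist_xx mulr0.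
have [[[m z] c] /= Pu maxu] :=
  @arg_maxP _ R _ (i0, x0, x0) (fun u => f u <= lams) f Pu0.
exists m, z, c; split=> //; last by rewrite /f /lams /= ler_pdivlMr // in Pu.
rewrite /f /= in Pu maxu; set lam := m.+1%:R ^+ 2 * dist z c in Pu maxu *.
(* The rounding: each |T|^2 dist y x that is at most [lams] is one of the values over which [lam] is
   the maximum. *)
have vv T : valid lams T -> valid lam T.
  case=> y hy; exists y => x xT.
  have Tpos : (0 < #|T|)%N by apply/card_gt0P; exists x.
  have ltT : (#|T|.-1 < #|X|)%N by rewrite prednK // max_card.
  by have := maxu (Ordinal ltT, y, x); rewrite /= prednK //; apply; apply: hy.
have pk p : packing_price lam p -> packing_price lams p.
  by case=> p0 h; split=> // T /vv; apply: h.
have near i : exists cA : X * {set X}, [/\ cA.2 \subset O i,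
    (1 - delta) * #|O i|%:R <= #|cA.2|%:R &
    forall x, x \in cA.2 -> #|O i|%:R ^+ 2 * dist cA.1 x <= 2 * cost dist (O i) / delta].
  have [E|nE] := eqVneq (O i) finset.set0.
    exists (x0, finset.set0); rewrite /= E cards0 mulr0 fintype.subxx; split=> // x.
    by rewrite inE.
  by have [y [A H]] := near_part d0 nE; exists (y, A).
have [g hg] := choice near.
pose Z := (\bigcup_i (g i).2)%SET.
have dg i j : i != j -> [disjoint (g i).2 & (g j).2].
  move=> ij; have [si _ _] := hg i; have [sj _ _] := hg j.
  exact: disjointWl si (disjointWr sj (dO i j ij)).
exists Z; split.
  have -> : #|Z|%:R = \sum_i #|(g i).2|%:R :> R.
    rewrite -sum1_card partition_disjoint_bigcup //= natr_sum; apply: eq_bigr => i _.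
    by rewrite sum1_card.
  apply: le_trans (_ : (1 - delta) * #|union_family O|%:R <= _).
    by apply: ler_wpM2l; rewrite ?subr_ge0 // ler_nat.
  rewrite /union_family -sum1_card partition_disjoint_bigcup //= natr_sum mulr_sumr.
  by apply: ler_sum => i _; rewrite sum1_card; have [] := hg i.
move=> p /pk pp; rewrite partition_disjoint_bigcup //=.
have each i : lams * \sum_(x in (g i).2) p x <= lams + 8 * cost dist (O i) / delta
    /\ (2 * cost dist (O i) / delta <= lams -> \sum_(x in (g i).2) p x <= 1).
  have [si _ hi] := hg i.
  have [E|nE] := eqVneq (O i) finset.set0.
    have -> : (g i).2 = finset.set0 by apply/eqP; rewrite -finset.subset0 -E.
    rewrite big_set0 mulr0; split; last by rewrite ler01.
    apply: addr_ge0 => //; apply: divr_ge0; last exact: ltW.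
    by apply: mulr_ge0 => //; apply: cost_ge0.
  have [| |h1 h2] := near_mass lams0 _ pp _ (subset_leq_card si) hi.
  - apply: divr_ge0; last exact: ltW.
    by apply: mulr_ge0 => //; apply: cost_ge0.
  - by rewrite card_gt0.
  by split=> //; apply: le_trans h1 _; lra.
(* If the optimum is 0, then so is [lams], by which the bound cannot be divided. All clusters then
   have cost 0, their near parts are valid, and each has price at most 1. *)
have [E|nE] := eqVneq opt0 0.
  have : \sum_i \sum_(x in (g i).2) p x <= \sum_(i < k) 1.
    apply: ler_sum => i _; apply: (each i).2.
    suff -> : cost dist (O i) = 0 by rewrite mulr0 mul0r.
    apply/eqP; move/eqP: E; rewrite /opt0 /total_cost psumr_eq0; last first.
      by move=> j _; apply: cost_ge0.
    by move=> /allP/(_ i); rewrite mem_index_enum => /(_ isT).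
  rewrite sumr_const card_ord; nra.
have lp : 0 < lams.
  by rewrite divr_gt0 // mulr_gt0 // lt_neqAle eq_sym nE.
rewrite -(ler_pM2l lp) mulr_sumr.
apply: le_trans (_ : \sum_(i < k) (lams + 8 * cost dist (O i) / delta) <= _).
  by apply: ler_sum => i _; have [] := each i.
rewrite big_split /= sumr_const card_ord -mulr_suml -mulr_sumr -/(total_cost _ _) -/opt0.
(* Equality holds: [lams] was chosen so that 8 opt / delta = delta k lams. *)
rewrite le_eqVlt; apply/orP; left; apply/eqP; rewrite /lams -mulr_natr; field.
by rewrite (gt_eqF k0') gt_eqF.
Qed.

(* A price that is constant and maximal off [F] is smallest, on average, on [F]. *)
Lemma average_price (tau : R) (p : X -> R) (F Z : {set X}) :
  (forall x, p x <= tau) -> (forall x, x \notin F -> p x = tau) ->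
  (#|F| <= #|Z|)%N ->
  #|Z|%:R * \sum_(x in F) p x <= #|F|%:R * \sum_(x in Z) p x.
Proof.
move=> ple pF leFZ.
have h1 : \sum_(x in F) p x <= #|F|%:R * tau.
  by rewrite mulr_natl -sumr_const; apply: ler_sum.
have h2 : #|Z|%:R * tau - \sum_(x in Z) p x <= #|F|%:R * tau - \sum_(x in F) p x.
  rewrite !mulr_natl -!sumr_const -!sumrB (big_setID (A := Z) F) /=.
  rewrite [X in _ + X]big1 ?addr0; last first.
    by move=> x; rewrite inE => /andP[xF _]; rewrite pF // subrr.
  rewrite (big_setID (A := F) Z) /= finset.setIC lerDl.
  by apply: sumr_ge0 => x _; rewrite subr_ge0.
have : #|F|%:R <= #|Z|%:R :> R by rewrite ler_nat.
have := ler0n R #|F|; nra.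
Qed.

End MinSum.

(** * Dual ascent, bins and trimming *)

Section DualAscent.
Variables (R : realType) (X : finType) (dist : X -> X -> R).
Variable rk : X -> nat.
Hypothesis rk_inj : injective rk.
Implicit Types (beta p : X -> R) (home : X -> nat) (core : X -> bool).

(** * Highest-priced points of a ball *)

(** The lexicographic order on pairs (beta, rk), expressed by the tests that a program can make;
    [rk] breaks ties so that the order is antisymmetric. *)
Definition key_le beta (w x : X) : bool :=
  (beta w <= beta x) && ~~ ((beta x <= beta w) && ~~ (rk w <= rk x)%N).

(** Among the subsets of given size of a ball, the most expensive one consists of the points from
    some lowest key [w] upwards. The ball around [c] is given by a point [z] on its boundary, so
    there are only n^3 candidates. *)
Definition candidate beta (c z w : X) : {set X} :=
  [set x | (dist c x <= dist c z) && key_le beta w x]%SET.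

Lemma key_le_refl beta : reflexive (key_le beta).
Proof. by move=> x; rewrite /key_le lexx leqnn. Qed.

Lemma key_le_total beta : total (key_le beta).
Proof.
move=> x y; rewrite /key_le; case: (ltgtP (beta x) (beta y)) => //= _.
by rewrite !negbK; apply: leq_total.
Qed.

Lemma key_le_trans beta : transitive (key_le beta).
Proof.
move=> y x z; rewrite /key_le => /andP[h1 h2] /andP[h3 h4].
rewrite (le_trans h1 h3) /=; apply/negP => /andP[h5 h6].
move: h2 h4; rewrite (le_trans h3 h5) (le_trans h5 h1) /= !negbK => h2 h4.
by rewrite (leq_trans h2 h4) in h6.
Qed.

Lemma key_le_anti beta : antisymmetric (key_le beta).
Proof.
move=> x y; rewrite /key_le => /andP[/andP[h1 h2] /andP[h3 h4]].
by move: h2 h4; rewrite h1 h3 /= !negbK => h2 h4; apply/rk_inj/eqP; rewrite eqn_leq h2.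
Qed.

(** Remove the point of least key until m points are left; the least remaining one is [w]. *)
Lemma exists_top_set beta (B : {set X}) (m : nat) : (0 < m <= #|B|)%N ->
  exists2 w, w \in B & #|[set x in B | key_le beta w x]%SET| = m.
Proof.
have [b] := ubnP #|B|; elim: b B => // b IH B ltB /andP[m0 mB].
have [x0 x0B] : exists x0, x0 \in B by apply/card_gt0P; apply: leq_trans mB.
have [w wB wmin] : exists2 w, w \in B & forall x, x \in B -> key_le beta w x.
  pose s := sort (key_le beta) (enum B).
  have ms x : (x \in s) = (x \in B) by rewrite mem_sort mem_enum.
  have : sorted (key_le beta) s by apply: sort_sorted; apply: key_le_total.
  case: s ms => [ms|w s ms /= srt]; first by have := ms x0; rewrite x0B in_nil.
  exists w; first by rewrite -ms mem_head.
  move=> x; rewrite -ms in_cons => /orP[/eqP ->|xs]; first exact: key_le_refl.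
  have /allP := order_path_min (@key_le_trans beta) srt.
  by apply.
have [E|ne] := eqVneq m #|B|.
  exists w => //; rewrite E; apply: eq_card => x; rewrite inE.
  by have [/wmin ->|] := boolP (x \in B).
have cB : #|B| = #|B :\ w|.+1 by rewrite (cardsD1 w B) wB.
have ltm : (0 < m <= #|B :\ w|)%N by rewrite m0; move: ne mB; rewrite cB; lia.
have [|v] := IH (B :\ w) _ ltm; first by rewrite -ltnS -cB.
rewrite !inE => /andP[vw vB] <-; exists v => //.
apply: eq_card => x; rewrite !inE; have [->|//] := eqVneq x w.
rewrite /= wB /=; apply/negbTE/negP => h.
by move/eqP: vw; apply; apply/(@key_le_anti beta)/andP; rewrite h wmin.
Qed.

(** Exchange argument: the parts of the two sets outside each other have the same size, and the
    price of [w] separates them. *)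
Lemma top_set_max beta p (B S : {set X}) (w : X) :
  (forall x y, key_le beta x y -> p x <= p y) -> S \subset B -> w \in B ->
  #|[set x in B | key_le beta w x]%SET| = #|S| ->
  \sum_(x in S) p x <= \sum_(x in [set x in B | key_le beta w x]%SET) p x.
Proof.
move=> mono sSB wB; set T := [set x in B | _]%SET => cT.
rewrite (big_setID T) [leRHS](big_setID S) /= finset.setIC lerD2l.
have cc : #|S :\: T| = #|T :\: S|.
  by have := cardsID T S; have := cardsID S T; rewrite finset.setIC; lia.
apply: le_trans (_ : \sum_(x in S :\: T) p w <= _).
  apply: ler_sum => x; rewrite !inE => /andP[+ xS].
  rewrite (fintype.subsetP sSB x xS) /= => nk; apply: mono.
  by have := key_le_total beta x w; rewrite (negbTE nk) orbF.
rewrite sumr_const cc -sumr_const; apply: ler_sum => x.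
by rewrite !inE => /andP[_ /andP[_ /mono]].
Qed.

(** * Prices during the dual ascent *)

Definition price (tau : R) beta (x : X) : R := if beta x <= 1 then beta x else tau.

Definition core_set home core (h : nat) : {set X} :=
  [set x | (home x == h) && core x]%SET.

Definition frozen beta : {set X} := [set x | beta x <= 1]%SET.

(* [beta] is the frozen price, or 2 for an active point; [tau] is the common    *)
(* price of the active points; [e] counts the tight sets met so far.            *)
Record dual_inv (lam : R) (P : Prop) (kmax : R) (e : nat) (tau : R) beta home core : Prop :=
  DualInv {
  dual_tau : 0 <= tau <= 1;
  dual_frozen : forall x, beta x <= 1 -> 0 <= beta x <= tau;
  dual_active : forall x, ~~ (beta x <= 1) -> [/\ beta x = 2, home x = 0%N & ~~ core x];
  dual_feasible : forall T, valid dist lam T -> \sum_(x in T) price tau beta x <= 1;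
  dual_home : forall x, beta x <= 1 -> (0 < home x <= e)%N;
  dual_core : exists cen : nat -> X, forall x, beta x <= 1 ->
    let C := core_set home core (home x) in
    [/\ forall y, y \in C -> #|C|%:R ^+ 2 * dist (cen (home x)) y <= lam,
        1 <= \sum_(y in C) beta y, 1 <= #|C|%:R * tau &
        ~~ core x -> dist (cen (home x)) x <= 3 * lam * beta x ^+ 2 /\
                     1 <= #|C|%:R * beta x];
  dual_mass : P -> \sum_(x in frozen beta) beta x < kmax
}.

Hypothesis dist_metric : is_metric dist.

Let dist_ge0 x y : 0 <= dist x y. Proof. by case: dist_metric. Qed.
Let dist_xx x : dist x x = 0.
Proof. by case: dist_metric => _ H _ _; apply/H. Qed.
Let distC x y : dist x y = dist y x. Proof. by case: dist_metric. Qed.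
Let dist_tri x y z : dist x z <= dist x y + dist y z.
Proof. by case: dist_metric. Qed.

Lemma price_key tau beta : 0 <= tau ->
  (forall x, beta x <= 1 -> 0 <= beta x <= tau) ->
  (forall x, ~~ (beta x <= 1) -> beta x = 2) ->
  forall x y, key_le beta x y -> price tau beta x <= price tau beta y.
Proof.
move=> tau0 hf ha x y /andP[le _]; rewrite /price.
have [hx|hx] := boolP (beta x <= 1); have [hy|hy] := boolP (beta y <= 1) => //.
  by have /andP[] := hf x hx.
by move: le; rewrite (ha x hx) => le; lra.
Qed.

Definition frozen_mass beta (T : {set X}) : R := \sum_(x in T | beta x <= 1) beta x.
Definition num_active beta (T : {set X}) : nat := #|[set x in T | ~~ (beta x <= 1)]%SET|.
(** The common active price at which the total price of [T] reaches 1. Without active points the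
    division by zero yields 0, hence the guards on [num_active]. *)
Definition tight_time beta (T : {set X}) : R :=
  (1 - frozen_mass beta T) / (num_active beta T)%:R.

Lemma sum_price tau beta (T : {set X}) :
  \sum_(x in T) price tau beta x = frozen_mass beta T + (num_active beta T)%:R * tau.
Proof.
rewrite (bigID (fun x => beta x <= 1)) /=; congr (_ + _).
  by apply: eq_bigr => x /andP[_ h]; rewrite /price h.
rewrite mulr_natl -sumr_const.
by apply: eq_big => x; [rewrite inE|move=> /andP[_ /negbTE h]; rewrite /price h].
Qed.

(** An active point alone is tight at price 1. This keeps the next price at most 1 and ensures that
    the search for a tight set succeeds. *)
Lemma candidate_self beta x : ~~ (beta x <= 1) ->
  num_active beta (candidate beta x x x) = 1%N /\
  tight_time beta (candidate beta x x x) = 1.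
Proof.
move=> xa; have -> : candidate beta x x x = [set x]%SET.
  apply/setP => y; rewrite !inE dist_xx; have [->|ne] := eqVneq y x.
    by rewrite dist_xx lexx key_le_refl.
  apply/negbTE; rewrite negb_and -ltNge lt_neqAle dist_ge0 andbT.
  case: dist_metric => _ H _ _.
  by have [/esym/H/esym/eqP|//] := eqVneq 0 (dist x y); rewrite (negbTE ne).
have n1 : num_active beta [set x]%SET = 1%N.
  rewrite -(cards1 x); apply: eq_card => y; rewrite !inE.
  by have [->|] := eqVneq y x; rewrite ?xa.
split=> //; rewrite /tight_time n1 /frozen_mass big1 ?subr0 ?divr1 //.
by move=> y /andP[]; rewrite inE => /eqP ->; rewrite (negbTE xa).
Qed.

Lemma sum_price_frozen beta T : num_active beta T = 0%N ->
  forall tau, \sum_(x in T) price tau beta x = frozen_mass beta T.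
Proof. by move=> h tau; rewrite sum_price h mul0r addr0. Qed.

(** Replace a valid set by equally many points of highest price in the ball that reaches its
    farthest point: the result is a candidate, still valid and at least as expensive. If it has
    active points it is not over-tight before [tau']; if not, its price has not changed. *)
Lemma feasible_of_candidates lam tau tau' beta :
  0 <= tau -> tau <= tau' ->
  (forall x, beta x <= 1 -> 0 <= beta x <= tau) ->
  (forall x, ~~ (beta x <= 1) -> beta x = 2) ->
  (forall T, valid dist lam T -> \sum_(x in T) price tau beta x <= 1) ->
  (forall c z w, let T := candidate beta c z w in
     (0 < num_active beta T)%N -> #|T|%:R ^+ 2 * dist c z <= lam ->
     tau' <= tight_time beta T) ->
  forall T, valid dist lam T -> \sum_(x in T) price tau' beta x <= 1.
Proof.
move=> tau0 lett hf ha feas hcand S vS.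
have [na0|na0] := posnP (num_active beta S).
  by rewrite sum_price_frozen // -(sum_price_frozen na0 tau); apply: feas.
case: (vS) => c hc.
have [s0 s0S] : exists s0, s0 \in S.
  by move: na0 => /card_gt0P[x]; rewrite inE => /andP[xS _]; exists x.
have [z zS zmax] := @arg_maxP _ R _ s0 (mem S) (fun x => dist c x) s0S.
pose B := [set x | dist c x <= dist c z]%SET.
have sSB : S \subset B by apply/fintype.subsetP => x xS; rewrite inE; apply: zmax.
have [|w wB cT] := @exists_top_set beta B #|S|.
  by rewrite subset_leq_card // andbT; apply/card_gt0P; exists s0.
have TE : candidate beta c z w = [set x in B | key_le beta w x]%SET.
  by apply/setP => x; rewrite !inE.
have hf' x : beta x <= 1 -> 0 <= beta x <= tau'.
  by move=> /hf /andP[-> h]; apply: le_trans h lett.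
have mono := price_key (le_trans tau0 lett) hf' ha.
apply: le_trans (top_set_max mono sSB wB cT) _; rewrite -TE.
have zB : z \in B by rewrite inE.
have vT : #|candidate beta c z w|%:R ^+ 2 * dist c z <= lam by rewrite TE cT; apply: hc.
have [na1|na1] := posnP (num_active beta (candidate beta c z w)).
  rewrite sum_price_frozen // -(sum_price_frozen na1 tau); apply: feas.
  exists c => x; rewrite inE => /andP[xz _]; apply: le_trans vT.
  by apply: ler_wpM2l => //; rewrite exprn_ge0.
have := hcand c z w na1 vT; rewrite /tight_time ler_pdivlMr ?ltr0n // sum_price; lra.
Qed.

Definition next_beta (tau' : R) (T : {set X}) beta (x : X) : R :=
  if x \in T then price tau' beta x else beta x.

(** [conf] is the home of a core met by [T], or 0 if there is none. In the latter case all of [T]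
    becomes the new core [e.+1], and frozen points of [T] leave the pool they were in; otherwise
    only newly frozen points get a home. *)
Definition next_home (e : nat) (conf : nat) (T : {set X}) beta home (x : X) : nat :=
  if x \in T then
    if conf == 0%N then e.+1 else if beta x <= 1 then home x else conf
  else home x.

Definition next_core (conf : nat) (T : {set X}) core (x : X) : bool :=
  if (x \in T) && (conf == 0%N) then true else core x.

Lemma dual_step lam (P : Prop) kmax e tau beta home core c z w conf :
  let T := candidate beta c z w in let tau' := tight_time beta T in
  dual_inv lam P kmax e tau beta home core ->
  (0 < num_active beta T)%N -> #|T|%:R ^+ 2 * dist c z <= lam ->
  (forall c z w, let T := candidate beta c z w in
     (0 < num_active beta T)%N -> #|T|%:R ^+ 2 * dist c z <= lam ->
     tau' <= tight_time beta T) ->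
  (conf = 0%N /\ (forall x, x \in T -> ~~ core x)) \/
    (exists2 y, y \in T & core y /\ conf = home y) ->
  (P -> \sum_(x in frozen beta) beta x + 1 < kmax) ->
  dual_inv lam P kmax e.+1 tau' (next_beta tau' T beta)
    (next_home e conf T beta home) (next_core conf T core).
Proof.
move=> T tau' [/andP[t0 t1] hf ha feas hh [cen hcen] _] na vT hcand hconf hmass.
have T_gt0 : (0 < #|T|)%N.
  by apply: leq_trans na _; apply: subset_leq_card; apply/fintype.subsetP => x; rewrite inE => /andP[].
have vT' : valid dist lam T.
  exists c => x; rewrite inE => /andP[xz _]; apply: le_trans vT.
  by apply: ler_wpM2l => //; rewrite exprn_ge0.
have na' : 0 < (num_active beta T)%:R :> R by rewrite ltr0n.
have lett : tau <= tau'.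
  by rewrite ler_pdivlMr // mulrC; have := feas T vT'; rewrite sum_price; lra.
have ha2 x : ~~ (beta x <= 1) -> beta x = 2 by move=> /ha[].
have feas' := feasible_of_candidates t0 lett hf ha2 feas hcand.
have tight : \sum_(x in T) price tau' beta x = 1.
  by rewrite sum_price mulrC divfK ?gt_eqF //; lra.
(* An active point of [T] is by itself a candidate with tight time 1. *)
have t1' : tau' <= 1.
  have [x xP] : exists x, x \in [set x in T | ~~ (beta x <= 1)]%SET by apply/card_gt0P.
  move: xP; rewrite inE => /andP[xT xa].
  have [n1 t1x] := candidate_self xa.
  have := hcand x x x; rewrite /= n1 t1x dist_xx mulr0; apply=> //.
  by apply: le_trans vT; rewrite mulr_ge0 // exprn_ge0.
have ple x : price tau' beta x <= tau'.
  by rewrite /price; case: ifP => // /hf /andP[_ h]; apply: le_trans h lett.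
have pge x : 0 <= price tau' beta x.
  by rewrite /price; case: ifP => [/hf /andP[]//|_]; apply: le_trans lett.
(* [T] is tight and no price exceeds [tau']. *)
have tT : 1 <= #|T|%:R * tau'.
  by rewrite -[leLHS]tight mulr_natl -sumr_const; apply: ler_sum.
have tau'_gt0 : 0 < tau'.
  rewrite lt_neqAle (le_trans t0 lett) andbT; apply/eqP => E.
  by move: tT; rewrite -E mulr0 leNgt ltr01.
have nb_frozen x (H : next_beta tau' T beta x <= 1) : beta x <= 1 \/ (x \in T /\ ~~ (beta x <= 1)).
  have [|xa] := boolP (beta x <= 1); [by left|right; split=> //].
  by move: H; rewrite /next_beta; case: ifP => // _; rewrite (negbTE xa).
have nb_old x : beta x <= 1 -> next_beta tau' T beta x = beta x.
  by move=> h; rewrite /next_beta /price h; case: ifP.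
have nb_new x : x \in T -> next_beta tau' T beta x = price tau' beta x.
  by rewrite /next_beta => ->.
have nb_act x : ~~ (next_beta tau' T beta x <= 1) -> x \notin T /\ ~~ (beta x <= 1).
  rewrite /next_beta; case: ifP => //= xT; rewrite /price.
  by case: ifP => [-> //|_]; rewrite t1'.
have lam0 : 0 <= lam by apply: le_trans vT; rewrite mulr_ge0 // exprn_ge0.
have core_frozen x : core x -> beta x <= 1.
  by move=> cx; apply/negPn/negP => /ha[_ _]; rewrite cx.
have conf0 : conf = 0%N -> forall x, x \in T -> ~~ core x.
  case: hconf => [[]//|[y yT [cy ->]]] E.
  by have := hh y (core_frozen y cy); rewrite E.
split.
- by rewrite (ltW tau'_gt0).
- move=> x; rewrite /next_beta; case: ifP => [xT _|xT h]; first by rewrite pge ple.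
  by have /andP[-> h2] := hf x h; apply: le_trans h2 lett.
- move=> x /nb_act[xT xa]; rewrite /next_beta /next_home /next_core (negbTE xT) /=.
  exact: ha.
- move=> S vS; apply: le_trans (feas' S vS); apply: ler_sum => x _.
  by rewrite /price /next_beta /price; case: ifP; case: (x \in T); case: ifP => // -> // _;
     rewrite ?t1'.
- move=> x h; rewrite /next_home; case: ifP => xT; last first.
    case: (nb_frozen x h) => [/hh /andP[-> h2]|[]]; last by rewrite xT.
    by rewrite leqW.
  case: ifP => [_|c0]; first by rewrite leqnn.
  case: ifP => [/hh /andP[-> h2]|_]; first by rewrite leqW.
  case: hconf => [[E]|[y yT [cy ->]]]; first by rewrite E in c0.
  by have /andP[-> h2] := hh y (core_frozen y cy); rewrite leqW.
- have sumC (C : {set X}) : (forall y, y \in C -> beta y <= 1) ->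
      \sum_(y in C) next_beta tau' T beta y = \sum_(y in C) beta y.
    by move=> hC; apply: eq_bigr => y /hC; apply: nb_old.
  have Cfr h y : y \in core_set home core h -> beta y <= 1.
    by rewrite inE => /andP[_]; apply: core_frozen.
  have [c0|c0] := eqVneq conf 0%N.
    exists (fun h => if h == e.+1 then c else cen h) => x hx.
    have home_le y : (home y <= e)%N.
      by have [/hh /andP[]//|/ha[_ -> _]] := boolP (beta y <= 1).
    rewrite /= c0; have [xT|xT] := boolP (x \in T).
      have -> : next_home e 0 T beta home x = e.+1 by rewrite /next_home xT.
      rewrite eqxx; have -> : core_set (next_home e 0 T beta home) (next_core 0 T core) e.+1 = T.
        apply/setP => y; rewrite inE /next_home /next_core eqxx andbT.
        by case: (y \in T); rewrite ?eqxx // ltn_eqF // ltnS.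
      split=> //.
      + move=> y; rewrite inE => /andP[yz _]; apply: le_trans vT.
        by apply: ler_wpM2l => //; rewrite exprn_ge0.
      + by rewrite (eq_bigr _ nb_new) tight.
      + by rewrite /next_core xT.
    have -> : next_home e 0 T beta home x = home x by rewrite /next_home (negbTE xT).
    have -> : next_core 0 T core x = core x by rewrite /next_core (negbTE xT).
    rewrite ltn_eqF ?ltnS //=.
    have xf : beta x <= 1 by case: (nb_frozen x hx) => // -[]; rewrite (negbTE xT).
    have -> : core_set (next_home e 0 T beta home) (next_core 0 T core) (home x) =
              core_set home core (home x).
      apply/setP => y; rewrite !inE /next_home /next_core eqxx andbT.
      case: (boolP (y \in T)) => // yT.
      by rewrite (negbTE (conf0 c0 y yT)) andbF gtn_eqF // ltnS.
    have [h1 h2 h3 h4] := hcen x xf; split=> //.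
    + by rewrite sumC //; apply: Cfr.
    + by apply: le_trans h3 _; rewrite ler_wpM2l.
    + by rewrite nb_old.
  case: hconf => [[E]|[y yT [cy confE]]]; first by rewrite E in c0.
  have CE h : core_set (next_home e conf T beta home) (next_core conf T core) h =
              core_set home core h.
    apply/setP => v; rewrite !inE /next_home /next_core (negbTE c0) andbF.
    have [vf|va] := boolP (beta v <= 1); first by case: ifP.
    by have [_ _ /negbTE ->] := ha v va; rewrite !andbF.
  exists cen => x hx; rewrite /= CE {1}/next_core (negbTE c0) andbF.
  have [xf|xa] := boolP (beta x <= 1).
    have -> : next_home e conf T beta home x = home x.
      by rewrite /next_home (negbTE c0) xf; case: ifP.
    have [h1 h2 h3 h4] := hcen x xf; split=> //.
    + by rewrite sumC //; apply: Cfr.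
    + by apply: le_trans h3 _; rewrite ler_wpM2l.
    + by rewrite nb_old.
  have xT : x \in T by case: (nb_frozen x hx) => [|[]//]; rewrite (negbTE xa).
  have -> : next_home e conf T beta home x = conf.
    by rewrite /next_home xT (negbTE c0) (negbTE xa).
  have [h1 h2 h3 _] := hcen y (core_frozen y cy); rewrite confE.
  have h3' : 1 <= #|core_set home core (home y)|%:R * tau'.
    by apply: le_trans h3 _; rewrite ler_wpM2l.
  split=> //; first by rewrite sumC //; apply: Cfr.
  have -> : next_beta tau' T beta x = tau' by rewrite nb_new // /price (negbTE xa).
  move=> _; split=> //.
  (* A set of n points with n tau' >= 1 and n^2 u <= lam has radius u <= lam tau'^2. This applies
     both to the core that was met and to [T]. *)
  have far (n : nat) (u : R) : 0 <= u -> 1 <= n%:R * tau' -> n%:R ^+ 2 * u <= lam ->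
      u <= lam * tau' ^+ 2.
    move=> u0 hn hu; apply: le_trans (_ : (n%:R * tau') ^+ 2 * u <= _).
      by rewrite ler_peMl // expr_ge1 // (le_trans ler01).
    by rewrite exprMn mulrAC; apply: ler_wpM2r => //; rewrite exprn_ge0 // ltW.
  have d1 : dist (cen (home y)) y <= lam * tau' ^+ 2.
    by apply: (far _ _ (dist_ge0 _ _) h3'); apply: h1; rewrite inE eqxx.
  have inT v : v \in T -> dist c v <= lam * tau' ^+ 2.
    move=> vT2; apply: (far _ _ (dist_ge0 _ _) tT); apply: le_trans vT.
    by apply: ler_wpM2l; [rewrite exprn_ge0|move: vT2; rewrite inE => /andP[]].
  have d2 := inT y yT; have d3 := inT x xT.
  have := dist_tri (cen (home y)) y x; have := dist_tri y c x; rewrite (distC y c); lra.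
- move=> /hmass; apply: le_lt_trans.
  rewrite (bigID (mem T)) /= [X in _ <= X + _](bigID (mem T)) /=.
  have -> : \sum_(x in frozen (next_beta tau' T beta) | x \notin T) next_beta tau' T beta x
    = \sum_(x in frozen beta | x \notin T) beta x.
    apply: eq_big => x; last by move=> /andP[_ /negbTE xT]; rewrite /next_beta xT.
    have [xT|xT] := boolP (x \in T); rewrite ?andbF ?andbT //=.
    by rewrite !inE /next_beta (negbTE xT).
  have h1 : \sum_(x in frozen (next_beta tau' T beta) | x \in T) next_beta tau' T beta x <= 1.
    rewrite -[leRHS]tight [leRHS](bigID (mem (frozen (next_beta tau' T beta)))) /=.
    rewrite ler_wpDr //; first by apply: sumr_ge0.
    rewrite le_eqVlt; apply/orP; left; apply/eqP.
    by apply: eq_big => x; [rewrite andbC|move=> /andP[_ xT]; rewrite nb_new].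
  have h2 : 0 <= \sum_(x in frozen beta | x \in T) beta x.
    by apply: sumr_ge0 => x /andP[]; rewrite inE => /hf /andP[].
  lra.
Qed.

Lemma dual_init lam P kmax (x0 : X) : 0 < kmax ->
  dual_inv lam P kmax 0 0 (fun=> 2) (fun=> 0%N) (fun=> false).
Proof.
move=> kmax0; have n2 : (2 <= 1 :> R) = false by lra.
split=> //; try by move=> x; rewrite n2.
- by rewrite lexx ler01.
- by move=> T _; rewrite big1 ?ler01 // => x _; rewrite /price n2.
- by exists (fun=> x0) => x; rewrite n2.
- by move=> _; rewrite big1 // => x; rewrite inE n2.
Qed.

Lemma frozen_mass_lt lam P kmax e tau beta home core (k n' : nat) (delta : R) :
  dual_inv lam P kmax e tau beta home core -> (0 < k)%N -> (0 < n')%N -> 0 < delta ->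
  adequate dist k n' delta lam -> #|frozen beta|%:R < (1 - 4 * delta) * n'%:R ->
  \sum_(x in frozen beta) beta x + 1 < k.+1%:R.
Proof.
move=> [/andP[t0 t1] hf ha feas _ _ _] k0 n0 d0 [Z [cZ hZ]] ltF.
have k0' : 0 < k%:R :> R by rewrite ltr0n.
have n0' : 0 < n'%:R :> R by rewrite ltr0n.
have F0 := ler0n R #|frozen beta|.
have d4 : 0 < 1 - 4 * delta by rewrite -(pmulr_lgt0 _ n0') (le_lt_trans F0).
have ltFZ : #|frozen beta|%:R < #|Z|%:R :> R.
  by apply: lt_le_trans ltF _; apply: le_trans cZ; apply: ler_wpM2r; [exact: ltW|lra].
have SZ : \sum_(x in Z) price tau beta x <= (1 + delta) * k%:R.
  apply: hZ; split=> // x; rewrite /price; case: ifP => // /hf /andP[] //.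
have ple x : price tau beta x <= tau by rewrite /price; case: ifP => // /hf /andP[].
have pF x : x \notin frozen beta -> price tau beta x = tau.
  by rewrite inE /price => /negbTE ->.
have := average_price ple pF; move=> /(_ Z); rewrite -(ler_nat R) (ltW ltFZ) => /(_ isT).
have -> : \sum_(x in frozen beta) price tau beta x = \sum_(x in frozen beta) beta x.
  by apply: eq_bigr => x; rewrite inE /price => ->.
set S := \sum_(x in frozen beta) beta x => h.
rewrite -natr1 ltrD2r -(@ltr_pM2l _ #|Z|%:R); last by apply: le_lt_trans ltFZ.
apply: le_lt_trans h _.
apply: le_lt_trans (_ : (1 - 4 * delta) * n'%:R * ((1 + delta) * k%:R) < _).
  apply: le_trans (_ : #|frozen beta|%:R * ((1 + delta) * k%:R) <= _).
    by apply: ler_wpM2l.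
  by apply: ler_wpM2r; [rewrite mulr_ge0 ?ltW //; lra|exact: ltW].
apply: lt_le_trans (_ : (1 - delta) * n'%:R * k%:R <= _); last by rewrite ler_pM2r.
have -> : (1 - 4 * delta) * n'%:R * ((1 + delta) * k%:R) =
          ((1 - 4 * delta) * (1 + delta)) * (n'%:R * k%:R) by ring.
by rewrite -[ltRHS]mulrA ltr_pM2r ?mulr_gt0 //; nra.
Qed.

(** * Cost and loss of a trimmed cluster *)

(** The factor 4 allows a core to double in size when it absorbs the remainder of its pool. *)
Definition cluster_ok (lam : R) beta core (Y : {set X}) : Prop :=
  exists c, [/\ forall x, x \in Y -> ~~ core x -> dist c x <= 3 * lam * beta x ^+ 2,
    forall x, x \in Y -> core x -> #|Y|%:R ^+ 2 * dist c x <= 4 * lam &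
    \sum_(x in Y | ~~ core x) beta x <= 2].

(** With delta = eps / 8 the threshold on the price is 1 / (delta s), where s is the size of the
    cluster before trimming. *)
Definition keep (eps : R) beta core (s : nat) (x : X) : bool :=
  core x || (beta x * eps * s%:R <= 8).

(** Use the star around [c]. Core points contribute at most s * s * 4 lam / s^2 = 4 lam, at most 8
    lam / eps because eps <= 2. For a kept pool point, s * 3 lam beta^2 <= (24 lam / eps) beta, and
    the pool mass is at most 2. In total 8 + 48 = 56. *)
Lemma cluster_cost (lam eps : R) beta core (Y Y' : {set X}) :
  0 < eps <= 2 -> 0 <= lam -> (forall x, x \in Y -> 0 <= beta x) ->
  cluster_ok lam beta core Y ->
  (forall x, x \in Y' -> (x \in Y) && keep eps beta core #|Y| x) ->
  cost dist Y' <= 56 * lam / eps.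
Proof.
move=> /andP[e0 e2] lam0 b0 [c [hp hc hm]] sY.
have sYY : Y' \subset Y by apply/fintype.subsetP => x /sY /andP[].
have rhs0 : 0 <= 56 * lam / eps by rewrite divr_ge0 ?mulr_ge0 // ltW.
have [E|nE] := eqVneq Y finset.set0.
  have -> : Y' = finset.set0 by apply/eqP; rewrite -finset.subset0 -E.
  by rewrite /cost big_set0 mulr0.
apply: le_trans (cost_le_star dist_metric Y' c) _.
set s : R := #|Y|%:R in hp hc *.
have s0 : 0 < s by rewrite ltr0n card_gt0.
have leS : #|Y'|%:R <= s by rewrite ler_nat subset_leq_card.
apply: le_trans (_ : s * \sum_(x in Y') dist c x <= _).
  by apply: ler_wpM2r => //; apply: sumr_ge0.
rewrite (bigID core) /= mulrDr mulr_sumr [X in _ + X <= _]mulr_sumr.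
have hcore : \sum_(x in Y' | core x) s * dist c x <= 4 * lam.
  apply: le_trans (_ : \sum_(x in Y) 4 * lam / s <= _); last first.
    by rewrite sumr_const -[leLHS]mulr_natl mulrCA divff ?mulr1 // gt_eqF.
  rewrite [leRHS](bigID (fun x => (x \in Y') && core x)) /= ler_wpDr //.
    by apply: sumr_ge0 => x _; rewrite divr_ge0 ?mulr_ge0 // ltW.
  rewrite [leRHS](eq_bigl (fun x => (x \in Y') && core x)); last first.
    move=> x; rewrite /= andbA; congr andb.
    by have [/(fintype.subsetP sYY) ->|] := boolP (x \in Y'); rewrite ?andbF.
  apply: ler_sum => x /andP[xY cx]; rewrite ler_pdivlMr // mulrAC -expr2.
  by apply: hc => //; apply: (fintype.subsetP sYY).
have hpool : \sum_(x in Y' | ~~ core x) s * dist c x <= 48 * lam / eps.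
  apply: le_trans (_ : \sum_(x in Y | ~~ core x) (24 * lam / eps) * beta x <= _); last first.
    rewrite -mulr_sumr; apply: le_trans (_ : 24 * lam / eps * 2 <= _).
      by apply: ler_wpM2l => //; rewrite divr_ge0 ?mulr_ge0 // ltW.
    lra.
  rewrite [leRHS](bigID (mem Y')) /= ler_wpDr //.
    apply: sumr_ge0 => x /andP[/andP[xY _] _].
    by rewrite mulr_ge0 ?divr_ge0 ?mulr_ge0 ?b0 // ltW.
  rewrite [leRHS](eq_bigl (fun x => (x \in Y') && ~~ core x)); last first.
    move=> x; rewrite /= andbAC; congr andb.
    by have [/(fintype.subsetP sYY) ->|] := boolP (x \in Y'); rewrite ?andbF.
  apply: ler_sum => x /andP[xY ncx]; have /andP[xY2] := sY x xY.
  rewrite /keep (negbTE ncx) /= -/s => hk.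
  apply: le_trans (_ : s * (3 * lam * beta x ^+ 2) <= _).
    by rewrite ler_pM2l //; apply: hp.
  have -> : s * (3 * lam * beta x ^+ 2) = beta x * eps * s * (3 * lam * beta x / eps).
    by field; rewrite gt_eqF.
  have -> : 24 * lam / eps * beta x = 8 * (3 * lam * beta x / eps) by field; rewrite gt_eqF.
  apply: ler_wpM2r => //.
  by rewrite divr_ge0 ?mulr_ge0 ?b0 // ltW.
have h8 : 4 * lam <= 8 * lam / eps.
  by rewrite ler_pdivlMr //; nra.
lra.
Qed.

(** Dropped points have price above 8 / (eps s) and total price at most 2, so they number at most
    eps s / 4. *)
Lemma cluster_drop (lam eps : R) beta core (Y : {set X}) :
  0 < eps -> (forall x, x \in Y -> 0 <= beta x) -> cluster_ok lam beta core Y ->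
  4 * #|[set x in Y | ~~ keep eps beta core #|Y| x]%SET|%:R <= eps * #|Y|%:R.
Proof.
move=> e0 b0 [c [_ _ hm]]; set s : R := #|Y|%:R.
set D := [set x in Y | _]%SET.
have [E|nE] := eqVneq Y finset.set0.
  suff -> : D = finset.set0 by rewrite cards0 mulr0 mulr_ge0 // ltW.
  by apply/setP => x; rewrite !inE E inE.
have s0 : 0 < s by rewrite ltr0n card_gt0.
have h : \sum_(x in D) 8 / (eps * s) <= 2.
  apply: le_trans hm; rewrite [leRHS](bigID (mem D)) /= ler_wpDr //.
    by apply: sumr_ge0 => x /andP[/andP[xY _] _]; apply: b0.
  rewrite [leRHS](eq_bigl (mem D)); last first.
    move=> x; rewrite /= !inE /keep negb_or.
    by case: (x \in Y); case: (core x).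
  apply: ler_sum => x; rewrite inE /keep negb_or => /andP[_ /andP[_]].
  rewrite -ltNge -/s => /ltW hx; rewrite ler_pdivrMr ?mulr_gt0 //.
  by rewrite mulrA.
move: h; rewrite sumr_const -[leLHS]mulr_natl mulrA ler_pdivrMr ?mulr_gt0 // => h; lra.
Qed.

(** * Cutting the pools into bins *)

Definition label_set (lab : X -> nat) (a : nat) : {set X} := [set x | lab x == a]%SET.

(** State after treating the homes 1 to [h]: labels 1 to [K] are in use. The lower bound on masses
    is what limits the number of clusters. *)
Record bins_inv (lam : R) beta home core (h K : nat) (lab : X -> nat) : Prop := BinsInv {
  bins_in : forall x, (0 < home x <= h)%N -> (0 < lab x <= K)%N;
  bins_out : forall x, ~~ (0 < home x <= h)%N -> lab x = 0%N;
  bins_ok : forall a, (0 < a <= K)%N -> cluster_ok lam beta core (label_set lab a);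
  bins_mass : forall a, (0 < a <= K)%N -> 1 <= \sum_(x in label_set lab a) beta x
}.

Lemma sum_labels (T : nmodType) (f : X -> T) (lab : X -> nat) (K : nat) :
  (forall x, (lab x <= K)%N) ->
  \sum_(x | lab x != 0%N) f x = \sum_(a < K) \sum_(x in label_set lab a.+1) f x.
Proof.
move=> leK; rewrite (exchange_big_dep (fun x => lab x != 0%N)) /=; last first.
  by move=> a x _; rewrite inE => /eqP ->.
apply: eq_bigr => x nz; case E: (lab x) nz => [//|b] _.
have ltb : (b < K)%N by rewrite -E leK.
rewrite (big_pred1 (Ordinal ltb)) // => a; rewrite inE E eqSS eq_sym; by [].
Qed.

Definition in_pool home core (h : nat) (x : X) : bool := (home x == h) && ~~ core x.

(** State of the scan of one pool in the order of [rk]: [K1] labels existed before, labels up to [K]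
    are closed bins, and [K.+1] marks the open bin, of total price [mass]. *)
Record pool_inv beta home core (h K1 : nat) (lab1 : X -> nat) (i K : nat) (mass : R)
    (lab : X -> nat) : Prop := PoolInv {
  pool_in : forall x, in_pool home core h x -> (rk x < i)%N -> (K1 < lab x <= K.+1)%N;
  pool_out : forall x, ~~ (in_pool home core h x && (rk x < i)%N) -> lab x = lab1 x;
  pool_bin : forall a, (K1 < a <= K)%N -> 1 <= \sum_(x in label_set lab a) beta x <= 2;
  pool_cur : \sum_(x in label_set lab K.+1) beta x = mass;
  pool_mass : 0 <= mass < 1;
  pool_le : (K1 <= K)%N
}.

Lemma pool_init beta home core h K1 lab1 : (forall x, (lab1 x <= K1)%N) ->
  pool_inv beta home core h K1 lab1 0 K1 0 lab1.
Proof.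
move=> le1; split=> //.
- by move=> a; lia.
- rewrite big1 // => x; rewrite inE => /eqP E.
  by have := le1 x; rewrite E ltnn.
- by rewrite lexx ltr01.
Qed.

Lemma pool_skip beta home core h K1 lab1 x K mass lab :
  ~~ in_pool home core h x ->
  pool_inv beta home core h K1 lab1 (rk x) K mass lab ->
  pool_inv beta home core h K1 lab1 (rk x).+1 K mass lab.
Proof.
move=> nx [p1 p2 p3 p4 p5 p6]; split=> // y.
- move=> py; rewrite ltnS leq_eqVlt => /orP[/eqP /rk_inj E|]; last exact: p1.
  by rewrite -E py in nx.
- move=> h2; apply: p2; apply: contra h2 => /andP[-> h3]; exact: ltnW.
Qed.

Definition set_label (lab : X -> nat) (x : X) (a : nat) : X -> nat :=
  fun y => if y == x then a else lab y.

(** The open bin has mass below 1 and a point has price at most 1, so a bin that closes has mass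
    between 1 and 2. *)
Lemma pool_step beta home core h K1 lab1 x K mass lab :
  (forall x, (lab1 x <= K1)%N) -> in_pool home core h x -> 0 <= beta x <= 1 ->
  pool_inv beta home core h K1 lab1 (rk x) K mass lab ->
  pool_inv beta home core h K1 lab1 (rk x).+1
    (if 1 <= mass + beta x then K.+1 else K)
    (if 1 <= mass + beta x then 0 else mass + beta x) (set_label lab x K.+1).
Proof.
move=> le1 px /andP[b0 b1] [p1 p2 p3 p4 /andP[p5 p5'] p6].
have lx : lab x = lab1 x by apply: p2; rewrite px ltnn.
have sumK : \sum_(y in label_set (set_label lab x K.+1) K.+1) beta y = mass + beta x.
  rewrite (bigD1 x) /=; last by rewrite inE /set_label eqxx.
  rewrite addrC; congr (_ + _); rewrite -p4; apply: eq_bigl => y.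
  rewrite !inE /set_label; have [->|//] := eqVneq y x; rewrite ?andbT ?andbF //.
  by rewrite lx ltn_eqF // ltnS (leq_trans (le1 x)).
have sumA a : (K1 < a <= K)%N ->
    label_set (set_label lab x K.+1) a = label_set lab a.
  move=> ha; apply/setP => y; rewrite !inE /set_label; have [->|//] := eqVneq y x.
  rewrite lx; have := le1 x; lia.
have le_lab y : (lab y <= K.+1)%N.
  have [/andP[/p1 h1 /h1]|/p2 ->] := boolP (in_pool home core h y && (rk y < rk x)%N).
    by case/andP.
  by have := le1 y; lia.
set b := 1 <= mass + beta x.
have leKK : (K.+1 <= (if b then K.+1 else K).+1)%N by case: b.
split.
- move=> y py; rewrite ltnS leq_eqVlt /set_label => /orP[/eqP/rk_inj ->|lt].
    by rewrite eqxx leKK ltnS p6.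
  case: eqP => _; first by rewrite leKK ltnS p6.
  by have /andP[-> h2] := p1 y py lt; apply: leq_trans h2 leKK.
- move=> y ny; rewrite /set_label; case: eqP => [E|_].
    by move: ny; rewrite E px ltnSn.
  by apply: p2; apply: contra ny => /andP[-> h3]; exact: ltnW.
- move=> a ha; have [Ea|ne] := eqVneq a K.+1.
    move: ha; rewrite Ea sumK; case E: b; last by lia.
    by move=> _; rewrite -/b E /=; lra.
  have ha' : (K1 < a <= K)%N by move: ha; case: (b); lia.
  by rewrite sumA //; apply: p3.
- case E: b; last exact: sumK.
  rewrite big1 // => y; rewrite inE /set_label; case: (eqVneq y x) => _ /eqP E2; first by lia.
  by have := le_lab y; rewrite E2 ltnn.
- case E: b; first by rewrite lexx ltr01.
  by rewrite addr_ge0 //= ltNge -/b E.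
- by case: (b); rewrite ?leqW.
Qed.

Lemma bins_init lam beta home core : bins_inv lam beta home core 0 0 (fun=> 0%N).
Proof. by split=> // [x|a|a]; lia. Qed.

Section Close.
Variables (lam : R) (P : Prop) (kmax : R) (e : nat) (tau : R).
Variables (beta : X -> R) (home : X -> nat) (core : X -> bool).
Hypothesis inv : dual_inv lam P kmax e tau beta home core.

Lemma home_frozen x : (0 < home x)%N -> beta x <= 1.
Proof.
by move=> hx; apply/negPn/negP => /(dual_active inv)[_ E _]; rewrite E in hx.
Qed.

Definition open_label (h K : nat) (lab : X -> nat) (x : X) : nat :=
  if x \in core_set home core h then K.+1 else lab x.

(** Closed bins satisfy [cluster_ok] because pool points are close to the core's center. The
    leftover bin has mass below 1 and joins the core. As |C| beta x >= 1 for every pool point, the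
    leftover has at most |C| points, so the merged cluster has at most 2 |C|. *)
Lemma bins_close h K lab n K' mass lab' :
  let C := core_set home core h.+1 in
  let K1 := if C == finset.set0 then K else K.+1 in
  bins_inv lam beta home core h K lab ->
  (forall x, (rk x < n)%N) ->
  pool_inv beta home core h.+1 K1 (open_label h.+1 K lab) n K' mass lab' ->
  bins_inv lam beta home core h.+1 K'
    (fun x => if lab' x == K'.+1 then K1 else lab' x).
Proof.
move=> C K1 [b1 b2 b3 b4] ltn [p1 p2 p3 p4 /andP[p5 p5'] p6].
have [cen hcen] := dual_core inv.
have leK1 : (K <= K1)%N by rewrite /K1; case: ifP.
(* A frozen point's home has a core of mass at least 1, so an empty core means an empty home, and no
   label is spent on it. *)
have C_nonempty x : home x = h.+1 -> K1 = K.+1.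
  move=> hx; rewrite /K1; case: eqP => // E.
  have xf : beta x <= 1 by apply: home_frozen; rewrite hx.
  have [_ + _ _] := hcen x xf; rewrite hx -/C E big_set0.
  by rewrite leNgt ltr01.
have pool_lab x : in_pool home core h.+1 x -> (K1 < lab' x <= K'.+1)%N.
  by move=> px; apply: p1.
have core_lab x : home x = h.+1 -> core x -> lab' x = K.+1.
  move=> hx cx; rewrite p2 /open_label ?inE ?hx ?eqxx ?cx //.
  by rewrite /in_pool cx andbF.
have old_lab x : home x != h.+1 -> lab' x = lab x.
  move=> hx; rewrite p2 /open_label ?inE ?(negbTE hx) //.
  by rewrite /in_pool (negbTE hx).
have lab_le x : (lab x <= K)%N.
  by have [/b1/andP[]//|/b2 ->] := boolP (0 < home x <= h)%N.
have bpos x : (0 < home x)%N -> 0 <= beta x.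
  by move=> /home_frozen /(dual_frozen inv) /andP[].
set lab2 := fun x => _.
have lab2_old x : home x != h.+1 -> lab2 x = lab x.
  move=> hx; rewrite /lab2 old_lab //; case: eqP => // E.
  by have := lab_le x; rewrite E; lia.
have lab2_core x : home x = h.+1 -> core x -> lab2 x = K1.
  move=> hx cx; rewrite /lab2 core_lab // (C_nonempty x hx); case: eqP => //.
have lab2_pool x : in_pool home core h.+1 x -> (K1 <= lab2 x <= K')%N.
  by move=> px; have := pool_lab x px; rewrite /lab2; case: eqP; lia.
have set_old a : (0 < a <= K)%N -> label_set lab2 a = label_set lab a.
  move=> ha; apply/setP => x; rewrite !inE.
  have [hx|hx] := eqVneq (home x) h.+1; last by rewrite lab2_old.
  have -> : lab x = 0%N by apply: b2; rewrite hx ltnn andbF.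
  have : (K < lab2 x)%N.
    rewrite -(C_nonempty x hx); have [cx|cx] := boolP (core x); first by rewrite lab2_core.
    by have := lab2_pool x; rewrite /in_pool hx eqxx cx => /(_ isT) /andP[].
  lia.
have set_bin a : (K1 < a <= K')%N -> label_set lab2 a = label_set lab' a.
  move=> ha; apply/setP => x; rewrite !inE /lab2; case: (eqVneq (lab' x) K'.+1) => // E.
  by rewrite E; lia.
have bin_pool a x : (K1 < a <= K')%N -> lab' x = a -> in_pool home core h.+1 x.
  move=> ha E; have [hx|hx] := eqVneq (home x) h.+1.
    rewrite /in_pool hx eqxx /=; apply/negP => cx.
    by move: (core_lab x hx cx) (C_nonempty x hx); lia.
  by have := old_lab x hx; have := lab_le x; lia.
have set_core a : a = K1 -> K1 = K.+1 ->
    label_set lab2 a = C :|: [set x | in_pool home core h.+1 x && (lab' x == K'.+1)].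
  move=> -> E1; apply/setP => x; rewrite !inE.
  have [hx|hx] := eqVneq (home x) h.+1; last first.
    rewrite lab2_old // /in_pool (negbTE hx) /=.
    by have := lab_le x; lia.
  rewrite /in_pool hx eqxx /=; have [cx|cx] := boolP (core x).
    by rewrite lab2_core // eqxx.
  have := pool_lab x; rewrite /in_pool hx eqxx cx => /(_ isT).
  by rewrite /lab2; case: (eqVneq (lab' x) K'.+1) => [_|_] /=; lia.
have coreok : K1 = K.+1 -> cluster_ok lam beta core (label_set lab2 K1)
    /\ 1 <= \sum_(x in label_set lab2 K1) beta x.
  move=> E1; rewrite (set_core _ (erefl _) E1).
  set L := [set x | _ && _]%SET.
  have [x0 x0C] : exists x0, x0 \in C.
    by apply/set0Pn; move: E1; rewrite /K1; case: eqP => // _; lia.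
  have hx0 : home x0 = h.+1 by move: x0C; rewrite inE => /andP[/eqP].
  have x0f : beta x0 <= 1 by apply: home_frozen; rewrite hx0.
  have := hcen x0 x0f; rewrite /= hx0 -/C => -[c1 c2 c3 _].
  have dCL : [disjoint C & L].
    rewrite -finset.setI_eq0; apply/eqP/setP => x; rewrite !inE /in_pool.
    by case: (core x); rewrite ?andbF ?andbT //= andbF.
  have massL : \sum_(x in L) beta x = mass.
    rewrite -p4; apply: eq_bigl => x; rewrite !inE.
    have [/eqP E2|] := boolP (lab' x == K'.+1); rewrite ?andbT ?andbF //.
    have [hx|hx] := eqVneq (home x) h.+1; last first.
      by have := old_lab x hx; have := lab_le x; lia.
    rewrite /in_pool hx eqxx /=; apply/negP => cx.
    by move: (core_lab x hx cx) (C_nonempty x hx); lia.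
  have Lhome x : x \in L -> home x = h.+1 /\ ~~ core x.
    by rewrite inE => /andP[/andP[/eqP]].
  have LC x : x \in L ->
      dist (cen h.+1) x <= 3 * lam * beta x ^+ 2 /\ 1 <= #|C|%:R * beta x.
    move=> /Lhome[hx cx].
    have xf : beta x <= 1 by apply: home_frozen; rewrite hx.
    by have := hcen x xf; rewrite /= hx -/C => -[_ _ _]; apply.
  (* Each leftover point counts at most |C| beta x, and these prices sum to less than 1. *)
  have cardL : #|L|%:R <= #|C|%:R :> R.
    apply: le_trans (_ : #|C|%:R * \sum_(x in L) beta x <= _).
      rewrite mulr_sumr -[leLHS]mulr1 mulr_natl -sumr_const.
      by apply: ler_sum => x /LC[].
    by rewrite massL ler_piMr // ltW.
  split; last first.
    rewrite (eq_bigl [predU C & L]) /=; last by move=> x; rewrite !inE.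
    rewrite bigU //= ler_wpDr //.
    by apply: sumr_ge0 => x /Lhome[hx _]; apply: bpos; rewrite hx.
  exists (cen h.+1); split.
  - by move=> x; rewrite inE => /orP[|/LC[]//]; rewrite inE => /andP[_ ->].
  - move=> x xCL cx; have xC : x \in C.
      by move: xCL; rewrite inE => /orP[//|/Lhome[_]]; rewrite cx.
    have cardU : #|C :|: L|%:R <= 2 * #|C|%:R :> R.
      by rewrite cardsU (_ : C :&: L = finset.set0) ?cards0 ?subn0 ?natrD;
        [lra|apply/eqP; rewrite finset.setI_eq0].
    apply: le_trans (_ : (2 * #|C|%:R) ^+ 2 * dist (cen h.+1) x <= _).
      by apply: ler_wpM2r => //; rewrite lerXn2r ?nnegrE ?mulr_ge0.
    by have := c1 x xC; rewrite exprMn; lra.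
  - rewrite (eq_bigl (mem L)); last first.
      move=> x; rewrite !inE; case: (boolP (core x)) => cx; rewrite /in_pool cx ?andbF //.
      by rewrite !andbT.
    by rewrite massL; lra.
have split_a a : (0 < a <= K')%N -> [\/ (0 < a <= K)%N, a = K1 /\ K1 = K.+1 | (K1 < a <= K')%N].
  move=> ha; have [l1|l1] := leqP a K; first by constructor 1; lia.
  have [l2|l2] := leqP a K1; last by constructor 3; lia.
  by constructor 2; move: l1 l2; rewrite /K1; case: ifP; lia.
split.
- move=> x hx; have [hx'|hx'] := eqVneq (home x) h.+1; last first.
    by rewrite lab2_old //; have := b1 x; lia.
  have [cx|cx] := boolP (core x).
    by rewrite lab2_core //; have := C_nonempty x hx'; lia.
  have := lab2_pool x; rewrite /in_pool hx' eqxx cx => /(_ isT).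
  by have := C_nonempty x hx'; lia.
- move=> x hx; have hx' : home x != h.+1 by lia.
  by rewrite lab2_old //; apply: b2; lia.
- move=> a /split_a[ha|[-> /coreok[]]|ha] //; first by rewrite set_old //; apply: b3.
  rewrite set_bin //; have /andP[_ h2] := p3 a ha.
  exists (cen h.+1); split.
  + move=> x; rewrite inE => /eqP /(bin_pool _ _ ha) /andP[/eqP hx cx] _.
    have xf : beta x <= 1 by apply: home_frozen; rewrite hx.
    by have [_ _ _ /(_ cx)[]] := hcen x xf; rewrite hx.
  + by move=> x; rewrite inE => /eqP /(bin_pool _ _ ha) /andP[_ /negbTE ->].
  + rewrite (eq_bigl (mem (label_set lab' a))) // => x; rewrite !inE.
    by have [/eqP /(bin_pool _ _ ha) /andP[_ ->]|] := boolP (lab' x == a).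
- move=> a /split_a[ha|[-> /coreok[]]|ha] //; first by rewrite set_old //; apply: b4.
  by rewrite set_bin //; have /andP[] := p3 a ha.
Qed.

Definition good_labels (k n' : nat) (eps lam' : R) (res : X -> nat) : Prop :=
  [/\ forall x, (res x <= k)%N, (#|[set x | res x != 0%N]%SET| <= n')%N,
      (1 - eps) * n'%:R <= #|[set x | res x != 0%N]%SET|%:R &
      \sum_(i < k) cost dist (label_set res i.+1) <= k%:R * (56 * lam' / eps)].

Lemma lab_frozen K lab x : bins_inv lam beta home core e K lab ->
  (lab x <= K)%N /\ (lab x != 0%N) = (x \in frozen beta).
Proof.
move=> [b1 b2 _ _]; split.
  by have [/b1/andP[]//|/b2 ->] := boolP (0 < home x <= e)%N.
rewrite inE; have [/(dual_home inv)/b1|/(dual_active inv)[_ h0 _]] := boolP (beta x <= 1).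
  by case: (lab x).
by rewrite b2 ?eqxx // h0.
Qed.

Lemma bins_count K lab : bins_inv lam beta home core e K lab -> P -> K%:R < kmax.
Proof.
move=> bi p; apply: le_lt_trans (dual_mass inv p).
rewrite (eq_bigl (fun x => lab x != 0%N)); last first.
  by move=> x; have [_ ->] := lab_frozen x bi.
rewrite (sum_labels _ (fun x => (lab_frozen x bi).1)).
have -> : K%:R = \sum_(a < K) (1 : R) by rewrite sumr_const card_ord.
by apply: ler_sum => a _; apply: (bins_mass bi); rewrite ltn_ord.
Qed.

(** Unless the cap n' is reached, what remains is at least (1 - eps / 4) |F| >= (1 - eps / 4) (1 -
    eps / 2) n' >= (1 - eps) n' when eps < 1; for eps >= 1 the bound is trivial. *)
Lemma labels_good (k n' : nat) (eps : R) K lab res :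
  0 <= lam -> 0 < eps -> (frozen beta != finset.set0 -> eps <= 2) ->
  (2 - eps) * n'%:R <= 2 * #|frozen beta|%:R ->
  bins_inv lam beta home core e K lab -> (K <= k)%N ->
  (forall x, res x != 0%N ->
     [/\ res x = lab x, (0 < home x)%N & keep eps beta core #|label_set lab (lab x)| x]) ->
  (#|[set x | res x != 0%N]%SET| <= n')%N ->
  (n' <= #|[set x | res x != 0%N]%SET|)%N \/
    (forall x, (0 < home x)%N -> keep eps beta core #|label_set lab (lab x)| x ->
       res x = lab x) ->
  good_labels k n' eps lam res.
Proof.
move=> lam0 eps0 eps2 cF bi leKk hres le_n hcount.
have bpos x : (0 < home x)%N -> 0 <= beta x.
  by move=> /home_frozen /(dual_frozen inv) /andP[].
have labx x := lab_frozen x bi.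
have Yhome a x : (0 < a)%N -> x \in label_set lab a -> (0 < home x)%N.
  rewrite inE => a0 /eqP E; have [_] := labx x; rewrite E -lt0n a0 inE => /esym.
  by move=> /(dual_home inv) /andP[].
have resK x : (res x <= K)%N.
  by have [->//|/hres[-> _ _]] := eqVneq (res x) 0%N; case: (labx x).
split=> //; first by move=> x; apply: leq_trans (resK x) leKk.
- case: hcount => [le|hkeep].
    have : n'%:R <= #|[set x | res x != 0%N]%SET|%:R :> R by rewrite ler_nat.
    by have := ler0n R n'; nra.
  have [e1|e1] := leP 1 eps.
    by apply: le_trans (_ : 0 <= _) => //; rewrite mulr_le0_ge0 ?subr_le0.
  pose D := [set x | (lab x != 0%N) && ~~ keep eps beta core #|label_set lab (lab x)| x]%SET.
  have cD : 4 * #|D|%:R <= eps * #|frozen beta|%:R.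
    have -> : #|frozen beta|%:R = \sum_(a < K) #|label_set lab a.+1|%:R :> R.
      transitivity (\sum_(x | lab x != 0%N) (1 : R)).
        by rewrite -sum1_card natr_sum; apply: eq_bigl => x; have [_ ->] := labx x.
      rewrite (sum_labels _ (fun x => (labx x).1)); apply: eq_bigr => a _.
      by rewrite sumr_const.
    have -> : #|D|%:R = \sum_(a < K)
        #|[set x in label_set lab a.+1 |
            ~~ keep eps beta core #|label_set lab a.+1| x]%SET|%:R :> R.
      transitivity (\sum_(x | lab x != 0%N)
          (~~ keep eps beta core #|label_set lab (lab x)| x)%:R : R).
        rewrite -sum1_card natr_sum big_mkcond [RHS]big_mkcond /=; apply: eq_bigr => x _.
        by rewrite inE; case: (lab x != 0%N) => //=; case: (keep _ _ _ _ _).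
      rewrite (sum_labels _ (fun x => (labx x).1)); apply: eq_bigr => a _.
      rewrite -sum1_card natr_sum big_mkcond [RHS]big_mkcond /=; apply: eq_bigr => x _.
      by rewrite !inE; case: eqP => // ->; case: (keep _ _ _ _ _).
    rewrite !mulr_sumr; apply: ler_sum => a _; apply: (@cluster_drop lam) => //.
      by move=> x /Yhome h; apply/bpos/h.
    by apply: (bins_ok bi); rewrite ltn_ord.
  have sF : #|frozen beta|%:R - #|D|%:R <= #|[set x | res x != 0%N]%SET|%:R :> R.
    rewrite lerBlDr -natrD ler_nat.
    apply: leq_trans (_ : #|[set x | res x != 0%N] :|: D| <= _)%N; last first.
      by rewrite cardsU leq_subr.
    apply: subset_leq_card; apply/fintype.subsetP => x xF; rewrite finset.in_setU !inE.
    have [_ E] := labx x; rewrite xF in E; rewrite E /=.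
    have [kx|] := boolP (keep _ _ _ _ _); rewrite ?orbT // orbF.
    rewrite hkeep //; move: xF; rewrite inE => /(dual_home inv) /andP[] //.
  have := ler0n R n'; nra.
apply: le_trans (_ : \sum_(i < k) 56 * lam / eps <= _); last first.
  by rewrite sumr_const card_ord -[leLHS]mulr_natl.
apply: ler_sum => i _.
have [E|/set0Pn[x0]] := eqVneq (label_set res i.+1) finset.set0.
  by rewrite E /cost big_set0 mulr0 divr_ge0 ?mulr_ge0 // ltW.
rewrite inE => /eqP Ex0.
have [|r0 h0 _] := hres x0; first by rewrite Ex0.
(* A labelled point is frozen, and points are frozen only when eps <= 2. *)
have e2 : eps <= 2.
  by apply: eps2; apply/set0Pn; exists x0; rewrite inE; apply: home_frozen.
apply: (@cluster_cost _ _ beta core (label_set lab i.+1)) => //; first by rewrite eps0.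
- by move=> x /Yhome h; apply/bpos/h.
- by apply: (bins_ok bi); rewrite /= -Ex0 resK.
- move=> x; rewrite inE => /eqP Ex; have [|rx hx kx] := hres x; first by rewrite Ex.
  by rewrite inE -rx Ex eqxx /=; move: kx; rewrite -rx Ex.
Qed.

End Close.
End DualAscent.

(** * Programs with bounded loops *)

(** Every loop runs n times, n being the first input cell. The semantics is then a total function,
    and a time bound can be read off the syntax. *)
Inductive lprog : Type :=
| LN of nat & nexp & nexp & nexp
| LR of nat & nexp & nexp & rexp
| LSeq of lprog & lprog
| LIf of bexp & lprog & lprog
| LSkip
| LFor of nat & lprog.

Definition nvar (a : nat) : nexp := NGet a (NConst 0) (NConst 0).
Definition rvar (a : nat) : rexp := RGet a (NConst 0) (NConst 0).
Definition ncell (a : nat) (i : nexp) : nexp := NGet a i (NConst 0).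
Definition rcell (a : nat) (i : nexp) : rexp := RGet a i (NConst 0).

Fixpoint compile (p : lprog) : program :=
  match p with
  | LN a i j e => NSet a i j e
  | LR a i j e => RSet a i j e
  | LSeq p q => Seq (compile p) (compile q)
  | LIf b p q => If b (compile p) (compile q)
  | LSkip => Skip
  | LFor v p =>
      Seq (NSet v (NConst 0) (NConst 0) (NConst 0))
        (While (BNot (BNle (nvar 0) (nvar v)))
          (Seq (compile p)
            (NSet v (NConst 0) (NConst 0) (NAdd (nvar v) (NConst 1)))))
  end.

Section Run.
Variable R : realType.
Implicit Type s : state R.

Definition loop (n v : nat) (f : state R -> state R) s : state R :=
  iteri n (fun i s' => nset (f s') v 0 0 i.+1) (nset s v 0 0 0).

Fixpoint run (p : lprog) s : state R :=
  match p with
  | LN a i j e => nset s a (neval s i) (neval s j) (neval s e)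
  | LR a i j e => rset s a (neval s i) (neval s j) (reval s e)
  | LSeq p q => run q (run p s)
  | LIf b p q => if beval s b then run p s else run q s
  | LSkip => s
  | LFor v p => loop (nmem s 0 0 0) v (run p) s
  end.

Fixpoint nwritten (p : lprog) : seq nat :=
  match p with
  | LN a _ _ _ => [:: a]
  | LR _ _ _ _ | LSkip => [::]
  | LSeq p q | LIf _ p q => nwritten p ++ nwritten q
  | LFor v p => v :: nwritten p
  end.

Fixpoint rwritten (p : lprog) : seq nat :=
  match p with
  | LR a _ _ _ => [:: a]
  | LN _ _ _ _ | LSkip => [::]
  | LSeq p q | LIf _ p q => rwritten p ++ rwritten q
  | LFor v p => rwritten p
  end.

Fixpoint wf (p : lprog) : bool :=
  match p with
  | LSeq p q | LIf _ p q => wf p && wf q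
  | LFor v p => [&& v != 0%N, v \notin nwritten p, 0%N \notin nwritten p & wf p]
  | _ => true
  end.

Lemma loop_ind (I : nat -> state R -> Prop) n v f s :
  I 0%N (nset s v 0 0 0) ->
  (forall i s, (i < n)%N -> I i s -> I i.+1 (nset (f s) v 0 0 i.+1)) ->
  I n (loop n v f s).
Proof.
move=> H0 HS; rewrite /loop.
suff H i : (i <= n)%N ->
    I i (iteri i (fun i s' => nset (f s') v 0 0 i.+1) (nset s v 0 0 0)) by apply: H.
by elim: i => //= i IH lt; apply: HS => //; apply: IH; apply: ltnW.
Qed.

Lemma run_nframe p s a i j : a \notin nwritten p ->
  nmem (run p s) a i j = nmem s a i j.
Proof.
elim: p s => //=.
- by move=> b e1 e2 e s; rewrite inE /upd => /negbTE ->.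
- by move=> p IHp q IHq s; rewrite mem_cat negb_or => /andP[hp hq]; rewrite IHq ?IHp.
- move=> b p IHp q IHq s; rewrite mem_cat negb_or => /andP[hp hq].
  by case: ifP; rewrite ?IHq ?IHp.
- move=> v p IHp s; rewrite inE negb_or => /andP[hv hp].
  apply: (loop_ind (I := fun _ s' => nmem s' a i j = nmem s a i j)) => [|m s' _ <-] /=.
    by rewrite /upd (negbTE hv).
  by rewrite /upd (negbTE hv) /= IHp.
Qed.

Lemma run_rframe p s a i j : a \notin rwritten p ->
  rmem (run p s) a i j = rmem s a i j.
Proof.
elim: p s => //=.
- by move=> b e1 e2 e s; rewrite inE /upd => /negbTE ->.
- by move=> p IHp q IHq s; rewrite mem_cat negb_or => /andP[hp hq]; rewrite IHq ?IHp.
- move=> b p IHp q IHq s; rewrite mem_cat negb_or => /andP[hp hq].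
  by case: ifP; rewrite ?IHq ?IHp.
- move=> v p IHp s hp.
  apply: (loop_ind (I := fun _ s' => rmem s' a i j = rmem s a i j)) => [|m s' _ <-] //=.
  by rewrite IHp.
Qed.

Fixpoint time_bound (p : lprog) (n : nat) : nat :=
  match p with
  | LSeq p q => time_bound p n + time_bound q n
  | LIf _ p q => (time_bound p n + time_bound q n).+1
  | LFor _ p => (n * (time_bound p n).+2).+2
  | _ => 1
  end.

(** As the body writes neither the counter nor array 0, the compiled loop makes exactly n passes and
    its state after i passes is [st i]. *)
Lemma exec_compile p s : wf p -> 0%N \notin nwritten p ->
  exists2 t, exec (compile p) s (run p s) t & (t <= time_bound p (nmem s 0%N 0%N 0%N))%N.
Proof.
elim: p s => //=.
- by move=> a i j e s _ _; exists 1%N => //; constructor.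
- by move=> a i j e s _ _; exists 1%N => //; constructor.
- move=> p IHp q IHq s /andP[wp wq]; rewrite mem_cat negb_or => /andP[hp hq].
  have [t1 E1 T1] := IHp s wp hp; have [t2 E2 T2] := IHq (run p s) wq hq.
  exists (t1 + t2)%N; first exact: ExecSeq E1 E2.
  by rewrite run_nframe // in T2; apply: leq_add.
- move=> b p IHp q IHq s /andP[wp wq]; rewrite mem_cat negb_or => /andP[hp hq].
  have [t1 E1 T1] := IHp s wp hp; have [t2 E2 T2] := IHq s wq hq.
  case: ifP => hb.
    exists t1.+1; first exact: ExecIfTrue hb E1.
    by rewrite ltnS (leq_trans T1) ?leq_addr.
  exists t2.+1; first by apply: ExecIfFalse E2; rewrite hb.
  by rewrite ltnS (leq_trans T2) ?leq_addl.
- by move=> s _ _; exists 1%N => //; constructor.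
move=> v p IHp s /and4P[v0 hv h0 wp] _.
set n := nmem s 0 0 0; set T := time_bound p n.
pose W := While (BNot (BNle (nvar 0) (nvar v)))
          (Seq (compile p) (NSet v (NConst 0) (NConst 0) (NAdd (nvar v) (NConst 1)))).
pose body i s' := nset (run p s') v 0 0 i.+1.
pose st i := iteri i body (nset s v 0 0 0).
have inv i : nmem (st i) 0 0 0 = n /\ nmem (st i) v 0 0 = i.
  elim: i => [|i [IH1 IH2]] /=; rewrite /st /= /upd ?eqxx /=.
    by rewrite (eq_sym 0%N) (negbTE v0).
  by rewrite (eq_sym 0%N) (negbTE v0) /= -/(st i) run_nframe.
have wloop m : (m <= n)%N ->
    exists2 t, exec W (st (n - m)%N) (st n) t & (t <= (m * T.+2).+1)%N.
  elim: m => [|m IH] lt.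
    rewrite subn0; exists 1%N => //; apply: ExecWhileFalse => /=.
    by have [-> ->] := inv n; rewrite leqnn.
  have [t2 E2 T2] := IH (ltnW lt).
  have [t1 E1 T1] := IHp (st (n - m.+1)%N) wp h0.
  have [i0 iv] := inv (n - m.+1)%N.
  exists ((t1 + 1) + t2).+1.
    apply: ExecWhileTrue E2; first by rewrite /= i0 iv -ltnNge; lia.
    apply: ExecSeq E1 _.
    have -> : st (n - m)%N = nset (run p (st (n - m.+1)%N)) v 0 0
        (nmem (run p (st (n - m.+1)%N)) v 0 0 + 1)%N.
      rewrite run_nframe // iv (_ : (n - m = (n - m.+1).+1)%N); last by lia.
      by rewrite /st /= addn1.
    exact: ExecNSet.
  rewrite i0 -/n -/T in T1; lia.
have [t E Tt] := wloop n (leqnn n); rewrite subnn in E.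
exists (1 + t)%N; first by apply: ExecSeq E; apply: ExecNSet.
by rewrite add1n ltnS.
Qed.

(** A loop raises the degree by one; sequences and branches add coefficients and degrees. *)
Lemma time_bound_poly p : exists a b, forall n, (time_bound p n <= a * n.+1 ^ b)%N.
Proof.
have mono (b c n : nat) : (b <= c)%N -> (n.+1 ^ b <= n.+1 ^ c)%N by apply: leq_pexp2l.
have one : exists a b : nat, forall n, (1 <= a * n.+1 ^ b)%N by exists 1%N, 0%N.
elim: p => //=.
- move=> p [a1 [b1 h1]] q [a2 [b2 h2]]; exists (a1 + a2)%N, (b1 + b2)%N => n.
  rewrite mulnDl leq_add //.
    by apply: leq_trans (h1 n) _; rewrite leq_mul2l mono ?orbT ?leq_addr.
  by apply: leq_trans (h2 n) _; rewrite leq_mul2l mono ?orbT ?leq_addl.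
- move=> _ p [a1 [b1 h1]] q [a2 [b2 h2]]; exists (a1 + a2).+1, (b1 + b2)%N => n.
  rewrite mulSn -addn1 addnC leq_add ?expn_gt0 // mulnDl leq_add //.
    by apply: leq_trans (h1 n) _; rewrite leq_mul2l mono ?orbT ?leq_addr.
  by apply: leq_trans (h2 n) _; rewrite leq_mul2l mono ?orbT ?leq_addl.
- move=> _ p [a [b h]]; exists (a + 4)%N, b.+1 => n.
  have hn := h n; have hp : (0 < n.+1 ^ b)%N by rewrite expn_gt0.
  rewrite expnS; nia.
Qed.

End Run.

(** * The algorithm *)

Definition setn (a : nat) (e : nexp) : lprog := LN a (NConst 0) (NConst 0) e.
Definition setr (a : nat) (e : rexp) : lprog := LR a (NConst 0) (NConst 0) e.
Definition setn_at (a : nat) (i e : nexp) : lprog := LN a i (NConst 0) e.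
Definition setr_at (a : nat) (i : nexp) (e : rexp) : lprog := LR a i (NConst 0) e.
Definition nincr (a : nat) : lprog := setn a (NAdd (nvar a) (NConst 1)).
Definition when (b : bexp) (p : lprog) : lprog := LIf b p LSkip.
Definition BNlt (e1 e2 : nexp) : bexp := BNot (BNle e2 e1).
Definition BNeq (e1 e2 : nexp) : bexp := BAnd (BNle e1 e2) (BNle e2 e1).
Definition BOr (b1 b2 : bexp) : bexp := BNot (BAnd (BNot b1) (BNot b2)).
Definition RConst (n : nat) : rexp := RNat (NConst n).

(* Layout of the memory. Integer arrays: 2, 3, 4 parameters of lambda; 5 index  *)
(* of the tight set; 6, 7, 8 parameters of a candidate; 9, 11 points; 10 home;  *)
(* 20 home, 21 core, 22 label, 23 the tight set, 24 result, 30 number of frozen *)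
(* points, 31 active and 32 all points of a candidate, 33, 34, 35 the best      *)
(* candidate, 36 the home met by the tight set, 37 number of labels, 38 whether *)
(* a core exists, 39 its label, 40 size of a cluster, 41 size of the result,    *)
(* 42 whether a result is known. Real arrays: 2 frozen price, 3 lambda, 4 mass  *)
(* of a candidate, 5 next price, 6 mass of a bin, 7 lambda of the result.       *)

Definition in_candidate (c z w x : nexp) : bexp :=
  BAnd (BRle (RGet 0 c x) (RGet 0 c z))
    (BAnd (BRle (rcell 2 w) (rcell 2 x))
      (BNot (BAnd (BRle (rcell 2 x) (rcell 2 w)) (BNot (BNle w x))))).

Definition is_frozen (x : nexp) : bexp := BRle (rcell 2 x) (RConst 1).

Definition scan_candidate : lprog :=
  LSeq (setn 32 (NConst 0)) (LSeq (setn 31 (NConst 0)) (LSeq (setr 4 (RConst 0))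
    (LFor 9 (when (in_candidate (nvar 6) (nvar 7) (nvar 8) (nvar 9))
      (LSeq (nincr 32)
        (LIf (is_frozen (nvar 9))
          (setr 4 (RAdd (rvar 4) (rcell 2 (nvar 9))))
          (nincr 31))))))).

Definition candidate_time : rexp := RDiv (RSub (RConst 1) (rvar 4)) (RNat (nvar 31)).

Definition try_candidate : lprog :=
  LSeq scan_candidate
    (when (BAnd (BNle (NConst 1) (nvar 31))
        (BAnd (BRle (RMul (RMul (RNat (nvar 32)) (RNat (nvar 32)))
                      (RGet 0 (nvar 6) (nvar 7))) (rvar 3))
          (BNot (BRle (rvar 5) candidate_time))))
      (LSeq (setr 5 candidate_time)
        (LSeq (setn 33 (nvar 6)) (LSeq (setn 34 (nvar 7)) (setn 35 (nvar 8)))))).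

(** The initial value 2 stands for no candidate; while a point is active, its singleton beats it
    with time 1. *)
Definition find_tight : lprog :=
  LSeq (setr 5 (RConst 2)) (LFor 6 (LFor 7 (LFor 8 try_candidate))).

Definition mark_tight : lprog :=
  LSeq (LFor 9 (LIf (in_candidate (nvar 33) (nvar 34) (nvar 35) (nvar 9))
      (setn_at 23 (nvar 9) (NConst 1)) (setn_at 23 (nvar 9) (NConst 0))))
    (LSeq (setn 36 (NConst 0))
      (LFor 9 (when (BAnd (BNle (NConst 1) (ncell 23 (nvar 9)))
                          (BNle (NConst 1) (ncell 21 (nvar 9))))
        (setn 36 (ncell 20 (nvar 9)))))).

(** Homes are assigned before the price is changed, since both tests refer to the old price. *)
Definition freeze_tight : lprog :=
  LFor 9 (when (BNle (NConst 1) (ncell 23 (nvar 9)))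
    (LSeq (LIf (BNle (nvar 36) (NConst 0))
        (LSeq (setn_at 20 (nvar 9) (NAdd (nvar 5) (NConst 1)))
              (setn_at 21 (nvar 9) (NConst 1)))
        (when (BNot (is_frozen (nvar 9))) (setn_at 20 (nvar 9) (nvar 36))))
      (when (BNot (is_frozen (nvar 9))) (setr_at 2 (nvar 9) (rvar 5))))).

Definition count_frozen : lprog :=
  LSeq (setn 30 (NConst 0)) (LFor 9 (when (is_frozen (nvar 9)) (nincr 30))).

Definition not_enough : bexp :=
  BNot (BRle (RMul (RSub (RConst 2) (rvar 1)) (RNat (ncell 0 (NConst 2))))
             (RMul (RConst 2) (RNat (nvar 30)))).

(** The number of events is not known in advance; the guard makes the remaining passes of the loop
    idle. *)
Definition dual_event : lprog :=
  LSeq count_frozen (when not_enough (LSeq find_tight (LSeq mark_tight freeze_tight))).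

Definition dual_reset : lprog :=
  LFor 9 (LSeq (setr_at 2 (nvar 9) (RConst 2)) (LSeq (setn_at 20 (nvar 9) (NConst 0))
    (LSeq (setn_at 21 (nvar 9) (NConst 0)) (setn_at 22 (nvar 9) (NConst 0))))).

Definition dual_phase : lprog := LSeq dual_reset (LFor 5 dual_event).

Definition home_is (x : nexp) : bexp := BNeq (ncell 20 x) (NAdd (nvar 10) (NConst 1)).
Definition is_core (x : nexp) : bexp := BNle (NConst 1) (ncell 21 x).
Definition new_label : nexp := NAdd (nvar 37) (NConst 1).

Definition label_core : lprog :=
  LSeq (setn 38 (NConst 0))
    (LSeq (LFor 9 (when (BAnd (home_is (nvar 9)) (is_core (nvar 9)))
        (LSeq (setn_at 22 (nvar 9) new_label) (setn 38 (NConst 1)))))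
      (LSeq (setn 37 (NAdd (nvar 37) (nvar 38))) (setn 39 (nvar 37)))).

Definition label_pool : lprog :=
  LSeq (setr 6 (RConst 0))
    (LFor 9 (when (BAnd (home_is (nvar 9)) (BNot (is_core (nvar 9))))
      (LSeq (setn_at 22 (nvar 9) new_label)
        (LSeq (setr 6 (RAdd (rvar 6) (rcell 2 (nvar 9))))
          (when (BRle (RConst 1) (rvar 6))
            (LSeq (nincr 37) (setr 6 (RConst 0)))))))).

Definition merge_leftover : lprog :=
  LFor 9 (when (BNeq (ncell 22 (nvar 9)) new_label) (setn_at 22 (nvar 9) (nvar 39))).

Definition bins_phase : lprog :=
  LSeq (setn 37 (NConst 0))
    (LFor 10 (LSeq label_core (LSeq label_pool merge_leftover))).

Definition count_label : lprog :=
  LSeq (setn 40 (NConst 0))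
    (LFor 11 (when (BNeq (ncell 22 (nvar 11)) (ncell 22 (nvar 9))) (nincr 40))).

Definition keep_test : bexp :=
  BAnd (BNle (NConst 1) (ncell 20 (nvar 9)))
    (BAnd (BOr (is_core (nvar 9))
        (BRle (RMul (RMul (rcell 2 (nvar 9)) (rvar 1)) (RNat (nvar 40))) (RConst 8)))
      (BNlt (nvar 41) (ncell 0 (NConst 2)))).

Definition trim_phase : lprog :=
  LSeq (setn 41 (NConst 0))
    (LFor 9 (LSeq count_label
      (LIf keep_test
        (LSeq (setn_at 24 (nvar 9) (ncell 22 (nvar 9))) (nincr 41))
        (setn_at 24 (nvar 9) (NConst 0))))).

(** Accepts a scale only if it gives at most k clusters and improves on the recorded one. Hence
    adequacy is never tested. *)
Definition record_phase : lprog :=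
  when (BAnd (BNle (nvar 37) (ncell 0 (NConst 1)))
             (BNot (BAnd (BNle (NConst 1) (nvar 42)) (BRle (rvar 7) (rvar 3)))))
    (LSeq (setn 42 (NConst 1)) (LSeq (setr 7 (rvar 3))
      (LFor 9 (setn_at 1 (nvar 9) (ncell 24 (nvar 9)))))).

Definition solve_lambda : lprog :=
  LSeq (setr 3 (RMul (RMul (RNat (NAdd (nvar 2) (NConst 1))) (RNat (NAdd (nvar 2) (NConst 1))))
                     (RGet 0 (nvar 3) (nvar 4))))
    (LSeq dual_phase (LSeq bins_phase (LSeq trim_phase record_phase))).

Definition min_sum_algorithm : lprog := LFor 2 (LFor 3 (LFor 4 solve_lambda)).

(** * Correctness of the program *)

Section Correctness.
Variables (R : realType) (X : finType) (dist : X -> X -> R) (k n' : nat) (eps : R).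
Implicit Types (s : state R) (beta : X -> R).

Definition rk (x : X) : nat := enum_rank x.

Lemma rk_inj : injective rk.
Proof. by move=> x y /ord_inj /enum_rank_inj. Qed.

Lemma rk_eq x y : (rk x == rk y) = (x == y).
Proof. exact: (inj_eq rk_inj). Qed.

Lemma rk_lt x : (rk x < #|X|)%N.
Proof. exact: ltn_ord. Qed.

Lemma rk_onto i : (i < #|X|)%N -> exists x, i = rk x.
Proof. by move=> lt; exists (enum_val (Ordinal lt)); rewrite /rk enum_valK. Qed.

Definition narr s (a : nat) (x : X) : nat := nmem s a (rk x) 0.
Definition rarr s (a : nat) (x : X) : R := rmem s a (rk x) 0.

Record has_input s : Prop := HasInput {
  input_n : nmem s 0 0 0 = #|X|;
  input_k : nmem s 0 1 0 = k;
  input_n' : nmem s 0 2 0 = n';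
  input_dist : forall x y, rmem s 0 (rk x) (rk y) = dist x y;
  input_eps : rmem s 1 0 0 = eps }.

Definition input_safe (p : lprog) : bool :=
  [&& 0%N \notin nwritten p, 0%N \notin rwritten p & 1%N \notin rwritten p].

Lemma run_input p s : input_safe p -> has_input s -> has_input (run p s).
Proof.
by case/and3P=> h0 h1 h2 [i1 i2 i3 i4 i5]; split=> *; rewrite ?run_nframe ?run_rframe.
Qed.

Lemma nset_input s v i j m : v != 0%N -> has_input s -> has_input (nset s v i j m).
Proof.
by move=> v0 [i1 i2 i3 i4 i5]; split=> //=; rewrite /upd eq_sym (negbTE v0).
Qed.

Lemma rset_input s v i j m : (1 < v)%N -> has_input s -> has_input (rset s v i j m).
Proof.
by case: v => [|[|v]] // _ [i1 i2 i3 i4 i5]; split.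
Qed.

Lemma rarr_frame p s a : a \notin rwritten p -> rarr (run p s) a = rarr s a.
Proof. by move=> h; apply: funext => x; rewrite /rarr run_rframe. Qed.

Lemma narr_frame p s a : a \notin nwritten p -> narr (run p s) a = narr s a.
Proof. by move=> h; apply: funext => x; rewrite /narr run_nframe. Qed.

Lemma nset_other s v i j m a i' j' : a != v ->
  nmem (nset s v i j m) a i' j' = nmem s a i' j'.
Proof. by move=> ne; rewrite /= /upd (negbTE ne). Qed.

Lemma run_when b p s : run (when b p) s = if beval s b then run p s else s.
Proof. by []. Qed.

Lemma run_if b p q s : run (LIf b p q) s = if beval s b then run p s else run q s.
Proof. by []. Qed.

Lemma run_seq p q s : run (LSeq p q) s = run q (run p s).
Proof. by []. Qed.

(** Invariant rule for loops over the points: the counter is the rank of the current point, and the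
    input survives the body. *)
Lemma for_ind (I : nat -> state R -> Prop) v p s :
  [&& v != 0%N, v \notin nwritten p & input_safe p] -> has_input s ->
  I 0%N (nset s v 0 0 0) ->
  (forall x s, has_input s -> nmem s v 0 0 = rk x -> I (rk x) s ->
     I (rk x).+1 (nset (run p s) v 0 0 (rk x).+1)) ->
  I #|X| (run (LFor v p) s).
Proof.
case/and3P=> v0 hv safe inp I0 IS /=; rewrite (input_n inp).
pose J i s := [/\ has_input s, nmem s v 0 0 = i & I i s].
suff [] : J #|X| (loop #|X| v (run p) s) by [].
apply: loop_ind.
  split=> //; first exact: nset_input.
  by rewrite /= /upd !eqxx.
move=> i s' /rk_onto[x ->] [h1 h2 h3]; split.
- by apply: nset_input => //; apply: run_input.
- by rewrite /= /upd !eqxx.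
- exact: IS.
Qed.

Lemma big_rk_step (T : Type) (idx : T) (op : Monoid.com_law idx) (f : X -> T) (y : X) :
  \big[op/idx]_(x | (rk x < (rk y).+1)%N) f x =
  op (\big[op/idx]_(x | (rk x < rk y)%N) f x) (f y).
Proof.
rewrite (bigD1 y) ?leqnn //= Monoid.mulmC; congr (op _ _); apply: eq_bigl => x.
by rewrite ltnS [RHS]ltn_neqAle rk_eq andbC.
Qed.

Lemma big_rk_all (T : Type) (idx : T) (op : Monoid.com_law idx) (f : X -> T) :
  \big[op/idx]_(x | (rk x < #|X|)%N) f x = \big[op/idx]_x f x.
Proof. by apply: eq_bigl => x; rewrite rk_lt. Qed.

Lemma big_rk0 (T : Type) (idx : T) (op : Monoid.com_law idx) (f : X -> T) :
  \big[op/idx]_(x | (rk x < 0)%N) f x = idx.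
Proof. by apply: big_pred0. Qed.

Lemma in_candidateP s c z w x c' z' w' x' : has_input s ->
  neval s c = rk c' -> neval s z = rk z' -> neval s w = rk w' -> neval s x = rk x' ->
  beval s (in_candidate c z w x) = (x' \in candidate dist rk (rarr s 2) c' z' w').
Proof.
by move=> inp E1 E2 E3 E4; rewrite inE /key_le /= E1 E2 E3 E4 !(input_dist inp).
Qed.

Lemma scan_candidateP s c z w : has_input s ->
  nmem s 6 0 0 = rk c -> nmem s 7 0 0 = rk z -> nmem s 8 0 0 = rk w ->
  let s' := run scan_candidate s in
  let T := candidate dist rk (rarr s 2) c z w in
  [/\ nmem s' 32 0 0 = #|T|, nmem s' 31 0 0 = num_active (rarr s 2) T &
      rmem s' 4 0 0 = frozen_mass (rarr s 2) T].
Proof.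
move=> inp E6 E7 E8 s' T.
set beta := rarr s 2 in T *.
pose I i s1 := [/\ nmem s1 6 0 0 = rk c, nmem s1 7 0 0 = rk z, nmem s1 8 0 0 = rk w &
  rarr s1 2 = beta] /\
  [/\ nmem s1 32 0 0 = (\sum_(x | rk x < i) (x \in T))%N,
      nmem s1 31 0 0 = (\sum_(x | rk x < i) ((x \in T) && ~~ (beta x <= 1)%R))%N &
      rmem s1 4 0 0 = \sum_(x | (rk x < i)%N) (if (x \in T) && (beta x <= 1) then beta x else 0)].
suff [_ [-> -> ->]] : I #|X| s'.
  rewrite !big_rk_all; split.
  - by rewrite -sum1_card [RHS]big_mkcond; apply: eq_bigr => x _; case: (x \in T).
  - rewrite /num_active -sum1_card [RHS]big_mkcond; apply: eq_bigr => x _.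
    by rewrite inE; case: (_ && _).
  - by rewrite /frozen_mass [RHS]big_mkcond.
rewrite /s' /scan_candidate !run_seq; apply: for_ind => //.
- by do 3! (apply: nset_input => // || apply: rset_input => //).
- by split; rewrite /= /upd /= ?big_rk0.
move=> x s1 inp1 E9 [[F6 F7 F8 F2] [G32 G31 G4]].
have ev := @in_candidateP s1 (nvar 6) (nvar 7) (nvar 8) (nvar 9) c z w x inp1 F6 F7 F8 E9.
rewrite F2 in ev; rewrite /I !big_rk_step -G32 -G31 -G4.
have Ex : rmem s1 2 (rk x) 0 = beta x by rewrite -F2.
rewrite run_when ev; case: (x \in T); last by rewrite /= /upd /= !addn0 addr0.
rewrite /= /upd /= E9 Ex; case: (beta x <= 1) => /=; rewrite /upd /= ?addn0 ?addr0 ?addn1 //.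
Qed.

Definition search_state beta (lam : R) s : Prop :=
  [/\ has_input s, rarr s 2 = beta & rmem s 3 0 0 = lam].

Lemma search_frame beta lam p s : input_safe p -> 2%N \notin rwritten p ->
  3%N \notin rwritten p -> search_state beta lam s -> search_state beta lam (run p s).
Proof.
by move=> h0 h2 h3 [i1 i2 i3]; split; rewrite ?rarr_frame ?run_rframe //; apply: run_input.
Qed.

Lemma search_nset beta lam s v i j m : v != 0%N ->
  search_state beta lam s -> search_state beta lam (nset s v i j m).
Proof. by move=> v0 [i1 i2 i3]; split=> //; apply: nset_input. Qed.

Definition eligible beta (lam : R) c z w : bool :=
  let T := candidate dist rk beta c z w in
  (0 < num_active beta T)%N && (#|T|%:R ^+ 2 * dist c z <= lam).

Definition best_ok beta lam s : Prop :=
  rmem s 5 0 0 = 2 \/ exists c z w, [/\ nmem s 33 0 0 = rk c, nmem s 34 0 0 = rk z,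
    nmem s 35 0 0 = rk w, eligible beta lam c z w &
    rmem s 5 0 0 = tight_time beta (candidate dist rk beta c z w)].

(** The effect of a search over the triples in [D], in a form that composes along the three nested
    loops. *)
Definition searched beta lam (D : X -> X -> X -> Prop) s s' : Prop :=
  [/\ best_ok beta lam s -> best_ok beta lam s', rmem s' 5 0 0 <= rmem s 5 0 0 &
    forall c z w, D c z w -> eligible beta lam c z w ->
      rmem s' 5 0 0 <= tight_time beta (candidate dist rk beta c z w)].

Lemma try_candidateP beta lam s c z w : search_state beta lam s ->
  nmem s 6 0 0 = rk c -> nmem s 7 0 0 = rk z -> nmem s 8 0 0 = rk w ->
  searched beta lam (fun c1 z1 w1 => [/\ c1 = c, z1 = z & w1 = w]) s (run try_candidate s).
Proof.
move=> [inp Eb El] E6 E7 E8.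
have [F32 F31 F4] := scan_candidateP inp E6 E7 E8; rewrite Eb in F32 F31 F4.
rewrite /try_candidate run_seq run_when.
set s1 := run scan_candidate s in F32 F31 F4 *.
set T := candidate dist rk beta c z w in F32 F31 F4.
have G5 : rmem s1 5 0 0 = rmem s 5 0 0 by rewrite run_rframe.
have G3 : rmem s1 3 0 0 = lam by rewrite run_rframe.
have G6 : nmem s1 6 0 0 = rk c by rewrite run_nframe.
have G7 : nmem s1 7 0 0 = rk z by rewrite run_nframe.
have G8 : nmem s1 8 0 0 = rk w by rewrite run_nframe.
have inp1 : has_input s1 by apply: run_input.
rewrite /= F31 F32 F4 G3 G6 G7 (input_dist inp1) G5 -expr2 -/(tight_time beta T).
have ok1 : best_ok beta lam s -> best_ok beta lam s1.
  by rewrite /best_ok G5 !run_nframe.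
have [el|nel] := boolP (eligible beta lam c z w); last first.
  move: (nel); rewrite /eligible -/T andbA => /negbTE ->; rewrite andFb.
  by split=> //; [rewrite G5|move=> c1 z1 w1 [-> -> ->]; rewrite (negbTE nel)].
move: (el); rewrite /eligible -/T andbA => ->; rewrite andTb.
case: ifP => [hlt|/negbFE hle]; last first.
  by split=> //; [rewrite G5|move=> c1 z1 w1 [-> -> ->]; rewrite G5].
rewrite -ltNge in hlt.
split; rewrite /= /upd /= ?F31 ?F4 -?/(tight_time beta T).
- move=> _; right; exists c, z, w; split=> //.
- exact: ltW.
- by move=> c1 z1 w1 [-> -> ->].
Qed.

Lemma find_tightP beta lam s : search_state beta lam s ->
  let s' := run find_tight s in best_ok beta lam s' /\
  forall c z w, eligible beta lam c z w ->
    rmem s' 5 0 0 <= tight_time beta (candidate dist rk beta c z w).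
Proof.
move=> st.
have H8 s1 c z : search_state beta lam s1 -> nmem s1 6 0 0 = rk c -> nmem s1 7 0 0 = rk z ->
    searched beta lam (fun c1 z1 w1 => c1 = c /\ z1 = z) s1 (run (LFor 8 try_candidate) s1).
  move=> st1 E6 E7.
  pose I i s2 := [/\ search_state beta lam s2, nmem s2 6 0 0 = rk c, nmem s2 7 0 0 = rk z &
    searched beta lam (fun c1 z1 w1 => [/\ c1 = c, z1 = z & (rk w1 < i)%N]) s1 s2].
  suff [_ _ _ [h1 h2 h3]] : I #|X| (run (LFor 8 try_candidate) s1).
    by split=> // c1 z1 w1 [-> ->]; apply: h3; split=> //; apply: rk_lt.
  apply: for_ind => //; first by case: st1.
    by split=> //; [apply: search_nset|split=> // c1 z1 w1 []].
  move=> w s2 inp2 E8 [st2 F6 F7 [h1 h2 h3]].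
  have [g1 g2 g3] := try_candidateP st2 F6 F7 E8.
  split.
  - by apply: search_nset => //; apply: search_frame.
  - by rewrite nset_other // run_nframe.
  - by rewrite nset_other // run_nframe.
  - split; first by move=> /h1/g1.
      exact: le_trans g2 h2.
    move=> c1 z1 w1 [-> ->]; rewrite ltnS leq_eqVlt => /orP[/eqP/rk_inj ->|lt] el.
      exact: g3.
    by apply: le_trans g2 _; apply: h3.
have H7 s1 c : search_state beta lam s1 -> nmem s1 6 0 0 = rk c ->
    searched beta lam (fun c1 z1 w1 => c1 = c) s1 (run (LFor 7 (LFor 8 try_candidate)) s1).
  move=> st1 E6.
  pose I i s2 := [/\ search_state beta lam s2, nmem s2 6 0 0 = rk c &
    searched beta lam (fun c1 z1 w1 => c1 = c /\ (rk z1 < i)%N) s1 s2].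
  suff [_ _ [h1 h2 h3]] : I #|X| (run (LFor 7 (LFor 8 try_candidate)) s1).
    by split=> // c1 z1 w1 ->; apply: h3; split=> //; apply: rk_lt.
  apply: for_ind => //; first by case: st1.
    by split=> //; [apply: search_nset|split=> // c1 z1 w1 []].
  move=> z s2 inp2 E7 [st2 F6 [h1 h2 h3]].
  have [g1 g2 g3] := H8 _ _ _ st2 F6 E7.
  split.
  - by apply: search_nset => //; apply: search_frame.
  - by rewrite nset_other // run_nframe.
  - split; first by move=> /h1/g1.
      exact: le_trans g2 h2.
    move=> c1 z1 w1 [->]; rewrite ltnS leq_eqVlt => /orP[/eqP/rk_inj ->|lt] el.
      exact: g3.
    by apply: le_trans g2 _; apply: h3.
rewrite /find_tight run_seq; set s0 := run (setr _ _) s.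
have st0 : search_state beta lam s0.
  by case: st => inp Eb El; split=> //; apply: rset_input.
pose I i s2 := search_state beta lam s2 /\
    searched beta lam (fun c1 z1 w1 => (rk c1 < i)%N) s0 s2.
suff [_ [h1 h2 h3]] : I #|X| (run (LFor 6 (LFor 7 (LFor 8 try_candidate))) s0).
  split; first by apply: h1; left.
  by move=> c z w; apply: h3; apply: rk_lt.
apply: for_ind => //; first by case: st0.
  by split=> //; apply: search_nset.
move=> c s2 inp2 E6 [st2 [h1 h2 h3]].
have [g1 g2 g3] := H7 _ _ st2 E6.
split; first by apply: search_nset => //; apply: search_frame.
split; first by move=> /h1/g1.
  exact: le_trans g2 h2.
move=> c1 z1 w1; rewrite ltnS leq_eqVlt => /orP[/eqP/rk_inj ->|lt] el.
  exact: g3.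
by apply: le_trans g2 _; apply: h3 lt el.
Qed.

Definition coreb s (x : X) : bool := (0 < narr s 21 x)%N.

(** Invariant step for a loop that rewrites an array cell by cell. *)
Lemma rk_lt_step (T : Type) (f f' new old : X -> T) x :
  (forall y, f y = if (rk y < rk x)%N then new y else old y) ->
  f' x = new x -> (forall y, y != x -> f' y = f y) ->
  forall y, f' y = if (rk y < (rk x).+1)%N then new y else old y.
Proof.
move=> hf hx hy y; have [->|ne] := eqVneq y x; first by rewrite leqnn.
by rewrite hy // hf ltnS [in RHS]leq_eqVlt rk_eq (negbTE ne).
Qed.

Lemma rk_at x y : y != x -> (rk y == rk x) = false.
Proof. by move=> ne; rewrite rk_eq (negbTE ne). Qed.

(** If the tight set meets several cores, the last one scanned is retained; any of them would serve
    [dual_step]. *)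
Lemma mark_tightP s c z w : has_input s ->
  nmem s 33 0 0 = rk c -> nmem s 34 0 0 = rk z -> nmem s 35 0 0 = rk w ->
  let s' := run mark_tight s in
  let T := candidate dist rk (rarr s 2) c z w in
  let conf := nmem s' 36 0 0 in
  (forall x, (0 < narr s' 23 x)%N = (x \in T)) /\
  ((conf = 0%N /\ forall x, x \in T -> ~~ coreb s x) \/
   exists2 y, y \in T & coreb s y /\ conf = narr s 20 y).
Proof.
move=> inp E33 E34 E35 s' T.
rewrite /s' /mark_tight !run_seq; set p1 := LFor 9 (LIf _ _ _); set s1 := run p1 s.
have inp1 : has_input s1 by apply: run_input.
have M1 x : (0 < narr s1 23 x)%N = (x \in T).
  pose I i s2 := [/\ nmem s2 33 0 0 = rk c, nmem s2 34 0 0 = rk z, nmem s2 35 0 0 = rk w,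
    rarr s2 2 = rarr s 2 & forall x, (rk x < i)%N -> (0 < narr s2 23 x)%N = (x \in T)].
  suff [_ _ _ _] : I #|X| s1 by apply; apply: rk_lt.
  apply: for_ind => //.
  move=> y s2 inp2 E9 [F33 F34 F35 F2 IH].
  have ev := @in_candidateP s2 (nvar 33) (nvar 34) (nvar 35) (nvar 9) c z w y
    inp2 F33 F34 F35 E9.
  rewrite run_if ev F2 -/T; split.
  - by case: ifP.
  - by case: ifP.
  - by case: ifP.
  - by rewrite -F2; case: ifP.
  - move=> v; rewrite ltnS leq_eqVlt => /orP[/eqP/rk_inj ->|lt].
      by case: ifP; rewrite /narr /= /upd /= E9 eqxx.
    have ne : (rk v == rk y) = false by rewrite ltn_eqF.
    by rewrite -(IH v lt); case: ifP; rewrite /narr /= /upd /= E9 ne.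
set s2 := run (setn _ _) s1.
have inp2 : has_input s2 by apply: run_input.
pose I i s3 := [/\ narr s3 23 = narr s1 23, narr s3 21 = narr s 21, narr s3 20 = narr s 20 &
  (nmem s3 36 0 0 = 0%N /\ forall x, (rk x < i)%N -> x \in T -> ~~ coreb s x) \/
   exists2 y, y \in T & coreb s y /\ nmem s3 36 0 0 = narr s 20 y].
set p3 := LFor 9 _.
suff [h1 _ _ h2] : I #|X| (run p3 s2).
  split; first by move=> x; rewrite h1.
  case: h2 => [[h2 h3]|[y yT h2]]; last by right; exists y.
  by left; split=> // x; apply: h3; apply: rk_lt.
apply: for_ind => //.
  have F21 : narr s1 21 = narr s 21 by rewrite narr_frame.
  have F20 : narr s1 20 = narr s 20 by rewrite narr_frame.
  by split; rewrite -?F21 -?F20 //; left.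
move=> y s3 inp3 E9 [F23 F21 F20 IH].
have E23 : nmem s3 23 (rk y) 0 = narr s1 23 y by rewrite -F23.
have E21 : nmem s3 21 (rk y) 0 = narr s 21 y by rewrite -F21.
have E20 : nmem s3 20 (rk y) 0 = narr s 20 y by rewrite -F20.
rewrite run_when /= E9 E23 E21 M1 -/(coreb s y).
case: ifP => [/andP[yT cy]|hn].
  split.
  - by rewrite -F23; apply: funext => v; rewrite /narr /= /upd.
  - by rewrite -F21; apply: funext => v; rewrite /narr /= /upd.
  - by rewrite -F20; apply: funext => v; rewrite /narr /= /upd.
  - by right; exists y => //; split=> //; rewrite /= /upd /= E9.
split.
- by rewrite -F23.
- by rewrite -F21.
- by rewrite -F20.
- case: IH => [[h1 h2]|[v vT h]]; last by right; exists v.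
  left; split=> // v; rewrite ltnS leq_eqVlt => /orP[/eqP/rk_inj ->|lt]; last exact: h2.
  by move=> yT; apply: contraFN hn => cy; rewrite yT.
Qed.

Lemma freeze_tightP s (T : {set X}) : has_input s ->
  (forall x, (0 < narr s 23 x)%N = (x \in T)) ->
  let s' := run freeze_tight s in let conf := nmem s 36 0 0 in
  [/\ rarr s' 2 = next_beta (rmem s 5 0 0) T (rarr s 2),
      narr s' 20 = next_home (nmem s 5 0 0) conf T (rarr s 2) (narr s 20) &
      coreb s' = next_core conf T (coreb s)].
Proof.
move=> inp hT s' conf.
set nb := next_beta _ _ _; set nh := next_home _ _ _ _ _; set nc := next_core _ _ _.
pose I i s1 := [/\ forall x, rarr s1 2 x = if (rk x < i)%N then nb x else rarr s 2 x,
  forall x, narr s1 20 x = if (rk x < i)%N then nh x else narr s 20 x,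
  forall x, coreb s1 x = if (rk x < i)%N then nc x else coreb s x &
  [/\ narr s1 23 = narr s 23, nmem s1 36 0 0 = conf, nmem s1 5 0 0 = nmem s 5 0 0 &
      rmem s1 5 0 0 = rmem s 5 0 0]].
suff [h1 h2 h3 _] : I #|X| s'.
  by split; apply: funext => x; rewrite ?h1 ?h2 ?h3 rk_lt.
apply: for_ind => //.
move=> x s1 inp1 E9 [B1 B2 B3 [F23 F36 F5 G5]].
have E23 : nmem s1 23 (rk x) 0 = narr s 23 x by rewrite -F23.
have E2 : rmem s1 2 (rk x) 0 = rarr s 2 x by have := B1 x; rewrite ltnn.
have E20 := B2 x; rewrite ltnn in E20; have E21 := B3 x; rewrite ltnn in E21.
set s2 := nset _ _ _ _ _.
have hx : [/\ rarr s2 2 x = nb x, narr s2 20 x = nh x & coreb s2 x = nc x].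
  rewrite /nb /nh /nc /next_beta /next_home /next_core /price -hT.
  rewrite /s2 run_when /= E9 E23 F36; case: ifP => xT; last first.
    by split; rewrite // /coreb ?andbF.
  rewrite leqn0 /= /upd /=; case: (conf == 0%N) => /=;
    rewrite ?E9 ?E2 ?F5 ?G5; case Ef: (rarr s 2 x <= 1) => /=;
    rewrite /coreb /rarr /narr /= /upd /= ?E9 ?E2 ?F5 ?G5 ?F36 ?eqxx ?addn1 /= ?Ef /=
      /upd /= ?eqxx //.
have hy y : y != x -> [/\ rarr s2 2 y = rarr s1 2 y, narr s2 20 y = narr s1 20 y &
    coreb s2 y = coreb s1 y].
  move=> /rk_at ne; rewrite /s2 run_when; case: ifP => // _.
  rewrite run_seq run_when run_if; case: (beval s1 _); rewrite ?run_when.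
    case: ifP => _; rewrite /coreb /rarr /narr /= /upd /= ?E9 ?ne //.
  by case: (beval s1 _); case: ifP => _; rewrite /coreb /rarr /narr /= /upd /= ?E9 ?ne //.
have [hx1 hx2 hx3] := hx; split.
- by apply: (rk_lt_step B1) => // y /hy[].
- by apply: (rk_lt_step B2) => // y /hy[].
- by apply: (rk_lt_step B3) => // y /hy[].
split.
- by rewrite -F23; apply: funext => y; rewrite /narr /s2 nset_other // run_nframe.
- by rewrite nset_other // run_nframe.
- by rewrite nset_other // run_nframe.
- by rewrite -G5 -[LHS]/(rmem (run _ s1) 5 0 0) run_rframe.
Qed.

Lemma count_frozenP s : has_input s ->
  nmem (run count_frozen s) 30 0 0 = #|frozen (rarr s 2)|.
Proof.
move=> inp; rewrite /count_frozen run_seq.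
pose I i s1 := rarr s1 2 = rarr s 2 /\
  nmem s1 30 0 0 = (\sum_(x | rk x < i) (rarr s 2 x <= 1)%R)%N.
suff [_ ->] : I #|X| (run (LFor 9 (when (is_frozen (nvar 9)) (nincr 30)))
                        (run (setn 30 (NConst 0)) s)).
  rewrite big_rk_all -sum1_card [RHS]big_mkcond; apply: eq_bigr => x _.
  by rewrite inE; case: (_ <= _).
apply: for_ind => //; first exact: run_input.
  by split=> //; rewrite big_rk0.
move=> x s1 inp1 E9 [F2 G30]; rewrite /I big_rk_step -G30.
have E2 : rmem s1 2 (rk x) 0 = rarr s 2 x by rewrite -F2.
by rewrite run_when /= E9 E2; case: (_ <= _); rewrite /= /upd /= ?addn0.
Qed.

Hypothesis dist_metric : is_metric dist.
Hypothesis k_gt0 : (0 < k)%N.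
Hypothesis n'_bounds : (0 < n' <= #|X|)%N.
Hypothesis eps_gt0 : 0 < eps.

(** The mass bound of the invariant is conditional on adequacy because the ascent is run at every
    scale. The disjunction measures progress: each event freezes a point until enough are frozen. *)
Definition dual_state lam i s : Prop :=
  [/\ rmem s 3 0 0 = lam,
    exists tau, dual_inv dist lam (adequate dist k n' (eps / 8) lam) k.+1%:R i tau
      (rarr s 2) (narr s 20) (coreb s),
    (2 - eps) * n'%:R <= 2 * #|frozen (rarr s 2)|%:R \/ (i <= #|frozen (rarr s 2)|)%N &
    frozen (rarr s 2) != finset.set0 -> eps <= 2].

Lemma dual_weaken lam P kmax e tau beta home core :
  dual_inv dist lam P kmax e tau beta home core ->
  dual_inv dist lam P kmax e.+1 tau beta home core.
Proof.
case=> h1 h2 h3 h4 h5 h6 h7; split=> // x /h5 /andP[-> h]; exact: leqW.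
Qed.

Lemma dual_eventP lam i s : 0 <= lam -> has_input s -> nmem s 5 0 0 = i ->
  dual_state lam i s -> dual_state lam i.+1 (run dual_event s).
Proof.
move=> lam0 inp E5 [El [tau dinv] prog epsF].
set beta := rarr s 2 in dinv prog epsF *.
rewrite /dual_event run_seq run_when; set s1 := run count_frozen s.
have inp1 : has_input s1 by apply: run_input.
have G2 : rarr s1 2 = beta by rewrite rarr_frame.
have G20 : narr s1 20 = narr s 20 by rewrite narr_frame.
have G21 : coreb s1 = coreb s by apply: funext => x; rewrite /coreb narr_frame.
have G3 : rmem s1 3 0 0 = lam by rewrite run_rframe.
set F := frozen beta in prog epsF *.
have -> : beval s1 not_enough = (2 * #|F|%:R < (2 - eps) * n'%:R).
  by rewrite /= (input_eps inp1) (input_n' inp1) count_frozenP // -ltNge.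
rewrite !run_seq.
case: ifP => [guard|/negbT]; last first.
  rewrite -leNgt => enough; rewrite /dual_state G2 G20 G21 G3; split=> //.
    by exists tau; apply: dual_weaken.
  by left.
have n'0 : 0 < n'%:R :> R by rewrite ltr0n; case/andP: n'_bounds.
have F0 := ler0n R #|F|.
have eps2 : eps <= 2.
  have : 0 < (2 - eps) * n'%:R by apply: le_lt_trans guard; rewrite mulr_ge0.
  by rewrite pmulr_lgt0 // subr_gt0 => /ltW.
have [x0 x0a] : exists x0, ~~ (beta x0 <= 1).
  have ltF : (#|F| < #|X|)%N.
    apply: (@leq_trans n'); last by case/andP: n'_bounds.
    by rewrite -(ltr_nat R); have := mulr_gt0 eps_gt0 n'0; lra.
  have [x xF] : exists x, x \notin F.
    apply/existsP; rewrite -negb_forall; apply: contraTN ltF => /forallP h.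
    by rewrite -leqNgt; apply: subset_leq_card; apply/fintype.subsetP.
  by exists x; move: xF; rewrite inE.
have st1 : search_state beta lam s1 by split.
have [bok bmin] := find_tightP st1.
set s2 := run find_tight s1 in bok bmin *.
have elx0 : eligible beta lam x0 x0 x0.
  have [n1 _] := candidate_self rk dist_metric x0a.
  have -> : lam = lam + 0 by rewrite addr0.
  rewrite /eligible /= n1 /=; case: dist_metric => _ H _ _.
  by have /H -> := erefl x0; rewrite mulr0 addr0.
have best1 : rmem s2 5 0 0 <= 1.
  by have := bmin _ _ _ elx0; have [_ ->] := candidate_self rk dist_metric x0a.
(* The best time is at most 1, so the initial value 2 has been replaced by an actual candidate. *)
case: bok => [E|[c [z [w [E33 E34 E35 el E]]]]]; first by move: best1; rewrite E; lra.
have inp2 : has_input s2 by apply: run_input.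
have B2 : rarr s2 2 = beta by rewrite rarr_frame.
have [hT hconf] := mark_tightP inp2 E33 E34 E35; rewrite B2 in hT hconf.
set T := candidate dist rk beta c z w in el E hT hconf.
set s3 := run mark_tight s2 in hT hconf *.
have inp3 : has_input s3 by apply: run_input.
have [h1 h2 h3] := freeze_tightP inp3 hT.
set s4 := run freeze_tight s3 in h1 h2 h3 *.
have C2 : coreb s2 = coreb s.
  by rewrite -G21; apply: funext => x; rewrite /coreb narr_frame.
have C3 : coreb s3 = coreb s.
  by rewrite -C2; apply: funext => x; rewrite /coreb narr_frame.
have H2 : narr s2 20 = narr s 20 by rewrite -G20 narr_frame.
have H3 : narr s3 20 = narr s 20 by rewrite -H2 narr_frame.
have B3 : rarr s3 2 = beta by rewrite rarr_frame.
have N3 : nmem s3 5 0 0 = i by rewrite run_nframe // run_nframe // run_nframe.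
have R3 : rmem s3 5 0 0 = tight_time beta T by rewrite run_rframe.
rewrite B3 R3 in h1; rewrite B3 H3 N3 in h2; rewrite C3 in h3; rewrite C2 H2 in hconf.
case/andP: (el) => na vT.
have hmass : adequate dist k n' (eps / 8) lam ->
    \sum_(x in frozen beta) beta x + 1 < k.+1%:R.
  move=> ad; apply: (frozen_mass_lt dinv) ad _ => //.
  - by case/andP: n'_bounds.
  - by rewrite divr_gt0.
  - by rewrite -/F; lra.
have dinv' : dual_inv dist lam (adequate dist k n' (eps / 8) lam) k.+1%:R i.+1
    (rmem s2 5 0 0) (rarr s4 2) (narr s4 20) (coreb s4).
  rewrite h1 h2 h3 E; apply: (dual_step rk_inj dist_metric dinv) => //.
  move=> c1 z1 w1 T1 n1 v1; rewrite -/T -E; apply: bmin.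
  by rewrite /eligible n1.
rewrite -E in h1.
split.
- by rewrite run_rframe // run_rframe // run_rframe.
- by exists (rmem s2 5 0 0).
(* The tight set contains an active point, so the set of frozen points grows strictly. *)
- case: prog => [enough|le_i]; first by move: guard; rewrite ltNge enough.
  right; apply: leq_ltn_trans le_i _; apply: proper_card; apply/properP; split.
    apply/fintype.subsetP => x; rewrite !inE h1 /next_beta /price => hx.
    by rewrite hx; case: ifP.
  move: na => /card_gt0P[x]; rewrite inE => /andP[xT xa].
  exists x; rewrite inE //; rewrite h1 /next_beta xT /price (negbTE xa).
  exact: best1.
- by [].
Qed.

Lemma dual_resetP s : has_input s ->
  let s' := run dual_reset s in
  [/\ rarr s' 2 = (fun=> 2), narr s' 20 = (fun=> 0%N), coreb s' = (fun=> false) &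
      narr s' 22 = (fun=> 0%N)].
Proof.
move=> inp s'.
pose I i s1 := forall x, (rk x < i)%N ->
  [/\ rarr s1 2 x = 2, narr s1 20 x = 0%N, narr s1 21 x = 0%N & narr s1 22 x = 0%N].
suff h : I #|X| s'.
  by split; apply: funext => x; have [h1 h2 h3 h4] := h x (rk_lt x); rewrite ?/coreb ?h3.
apply: for_ind => //.
move=> x s1 inp1 E9 IH y; rewrite ltnS leq_eqVlt => /orP[/eqP/rk_inj ->|lt].
  by rewrite /rarr /narr /= /upd /= E9 eqxx.
have [h1 h2 h3 h4] := IH y lt.
have ne : (rk y == rk x) = false by rewrite ltn_eqF.
by rewrite /rarr /narr /= /upd /= E9 ne.
Qed.

(** After n events either the target is met or all n points are frozen, which meets it since n' <=
    n. *)
Lemma dual_phaseP lam s : 0 <= lam -> has_input s -> rmem s 3 0 0 = lam ->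
  let s' := run dual_phase s in
  [/\ dual_state lam #|X| s', (2 - eps) * n'%:R <= 2 * #|frozen (rarr s' 2)|%:R &
      narr s' 22 = (fun=> 0%N)].
Proof.
move=> lam0 inp El s'; rewrite /s' /dual_phase run_seq; set s1 := run dual_reset s.
have inp1 : has_input s1 by apply: run_input.
have [h1 h2 h3 h4] := dual_resetP inp; rewrite -/s1 in h1 h2 h3 h4.
have [x0 _] : exists x0 : X, true.
  by case/andP: n'_bounds => a b; have /card_gt0P[x _] := leq_trans a b; exists x.
have F0 : frozen (fun _ : X => 2 : R) = finset.set0.
  by apply/setP => x; rewrite !inE; apply/negbTE; rewrite -ltNge; lra.
pose I i s2 := dual_state lam i s2 /\ narr s2 22 = (fun=> 0%N).
have [st E22] : I #|X| (run (LFor 5 dual_event) s1).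
  apply: for_ind => //.
    split; last exact: h4.
    have -> : dual_state lam 0 (nset s1 5 0 0 0) = dual_state lam 0 s1 by [].
    rewrite /dual_state h1 h2 h3 F0 eqxx; split=> //; first by rewrite run_rframe.
      by exists 0; apply: dual_init.
    by right.
  move=> x s2 inp2 E5 [st2 E22].
  have st3 := dual_eventP lam0 inp2 E5 st2.
  by split; [exact: st3|rewrite -E22; apply: funext => y; rewrite /narr nset_other // run_nframe].
split=> //; case: st => _ _ [//|le] _.
have : n'%:R <= #|frozen (rarr (run (LFor 5 dual_event) s1) 2)|%:R :> R.
  by rewrite ler_nat; apply: leq_trans le; case/andP: n'_bounds.
have := mulr_ge0 (ltW eps_gt0) (ler0n R n'); lra.
Qed.

Lemma home_isP s x h : nmem s 9 0 0 = rk x -> nmem s 10 0 0 = h ->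
  beval s (home_is (nvar 9)) = (narr s 20 x == h.+1).
Proof. by move=> E9 E10; rewrite /= E9 E10 addn1 eqn_leq. Qed.

Lemma is_coreP s x : nmem s 9 0 0 = rk x -> beval s (is_core (nvar 9)) = coreb s x.
Proof. by move=> E9; rewrite /= E9. Qed.

Lemma beval_and s b1 b2 : beval s (BAnd b1 b2) = beval s b1 && beval s b2.
Proof. by []. Qed.

Lemma beval_or s b1 b2 : beval s (BOr b1 b2) = beval s b1 || beval s b2.
Proof. by rewrite /= -negb_or negbK. Qed.

Lemma label_coreP s h : has_input s -> nmem s 10 0 0 = h ->
  let s' := run label_core s in
  let K := nmem s 37 0 0 in
  let K1 := if core_set (narr s 20) (coreb s) h.+1 == finset.set0 then K else K.+1 in
  [/\ narr s' 22 = open_label (narr s 20) (coreb s) h.+1 K (narr s 22),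
      nmem s' 37 0 0 = K1 & nmem s' 39 0 0 = K1].
Proof.
move=> inp E10 s' K K1; set C := core_set _ _ _ in K1 *.
set ol := open_label _ _ _ _ _.
rewrite /s' /label_core !run_seq; set s0 := run (setn 38 _) s; set p := LFor 9 _.
pose I i s1 := [/\ narr s1 20 = narr s 20, narr s1 21 = narr s 21, nmem s1 10 0 0 = h,
   nmem s1 37 0 0 = K & (forall x, narr s1 22 x = if (rk x < i)%N then ol x else narr s 22 x)
   /\ nmem s1 38 0 0 = [exists x, (rk x < i)%N && (x \in C)]].
have [_ _ _ F37 [F22 F38]] : I #|X| (run p s0).
  apply: for_ind => //; first exact: run_input.
    split=> //; split=> //=; rewrite /upd /=.
    by case: existsP => // -[x].
  move=> x s1 inp1 E9 [F20 F21 F10 F37 [F22 F38]].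
  have C1 : coreb s1 = coreb s by rewrite /coreb F21.
  rewrite run_when beval_and (home_isP E9 F10) (is_coreP E9) F20 C1.
  have -> : (narr s 20 x == h.+1) && coreb s x = (x \in C) by rewrite inE.
  have old : narr s1 22 x = narr s 22 x by rewrite F22 ltnn.
  split.
  - by rewrite -F20; case: ifP.
  - by rewrite -F21; case: ifP.
  - by rewrite -F10; case: ifP.
  - by rewrite -F37; case: ifP.
  split.
    apply: (rk_lt_step F22).
      rewrite /ol /open_label -/C; case: ifP => _; last exact: old.
      by rewrite /narr /= /upd /= E9 eqxx F37 addn1.
    move=> y /rk_at ne; case: ifP => // _.
    by rewrite /narr /= /upd /= E9 ne.
  case: ifP => xC.
    have -> : [exists y, (rk y < (rk x).+1)%N && (y \in C)].
      by apply/existsP; exists x; rewrite leqnn.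
    by [].
  rewrite /= /upd /= F38; congr nat_of_bool; apply: eq_existsb => y.
  have [->|ne] := eqVneq y x; first by rewrite xC !andbF.
  by rewrite ltnS [in RHS]leq_eqVlt rk_eq (negbTE ne).
have F38' : nmem (run p s0) 38 0 0 = (C != finset.set0).
  rewrite F38; congr nat_of_bool; apply/existsP/set0Pn => -[x].
    by case/andP=> _ xC; exists x.
  by move=> xC; exists x; rewrite rk_lt.
have F37' : (nmem (run p s0) 37 0 0 + nmem (run p s0) 38 0 0)%N = K1.
  by rewrite F37 F38' /K1; case: eqP; rewrite ?addn0 ?addn1.
split.
- by apply: funext => x; rewrite -[LHS]/(narr (run p s0) 22 x) F22 rk_lt.
- exact: F37'.
- exact: F37'.
Qed.

Lemma label_poolP s h beta home (lab1 := narr s 22) (K1 := nmem s 37 0 0) :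
  has_input s -> nmem s 10 0 0 = h ->
  rarr s 2 = beta -> narr s 20 = home ->
  (forall x, (lab1 x <= K1)%N) ->
  (forall x, (0 < home x)%N -> 0 <= beta x <= 1) ->
  let s' := run label_pool s in
  pool_inv rk beta home (coreb s) h.+1 K1 lab1 #|X| (nmem s' 37 0 0) (rmem s' 6 0 0)
    (narr s' 22).
Proof.
move=> inp E10 E2 E20 le1 hb s'; rewrite /s' /label_pool run_seq.
set s0 := run (setr _ _) s; set p := LFor 9 _.
pose I i s1 := [/\ narr s1 20 = home, narr s1 21 = narr s 21, nmem s1 10 0 0 = h,
   rarr s1 2 = beta & pool_inv rk beta home (coreb s) h.+1 K1 lab1 i (nmem s1 37 0 0)
     (rmem s1 6 0 0) (narr s1 22)].
suff [] : I #|X| (run p s0) by [].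
apply: for_ind => //; first exact: run_input.
  by split=> //; apply: pool_init.
move=> x s1 inp1 E9 [F20 F21 F10 F2 inv1].
have C1 : coreb s1 = coreb s by rewrite /coreb F21.
split; first by rewrite -F20; apply: funext => y; rewrite /narr nset_other // run_nframe.
- by rewrite -F21; apply: funext => y; rewrite /narr nset_other // run_nframe.
- by rewrite nset_other // run_nframe.
- by rewrite -F2 -[LHS]/(rarr (run _ s1) 2) rarr_frame.
rewrite run_when beval_and (home_isP E9 F10) F20.
have -> : beval s1 (BNot (is_core (nvar 9))) = ~~ coreb s x by rewrite -C1 -(is_coreP E9).
rewrite -/(in_pool home (coreb s) h.+1 x); case: ifP => px; last first.
  by apply: (pool_skip rk_inj _ inv1); rewrite px.
have bx : 0 <= beta x <= 1 by apply: hb; case/andP: px => /eqP ->.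
have := pool_step rk_inj le1 px bx inv1.
have Ex : rmem s1 2 (rk x) 0 = beta x by rewrite -F2.
set s2 := nset (run _ _) _ _ _ _.
have -> : set_label (narr s1 22) x (nmem s1 37 0 0).+1 = narr s2 22.
  apply: funext => y; rewrite /set_label /s2 !run_seq run_when; case: ifP => [/eqP ->|/negbT/rk_at ne].
    by case: ifP => _; rewrite /narr /= /upd /= E9 eqxx addn1.
  by case: ifP => _; rewrite /narr /= /upd /= E9 ne.
have -> : nmem s2 37 0 0 = if 1 <= rmem s1 6 0 0 + beta x then (nmem s1 37 0 0).+1
                           else nmem s1 37 0 0.
  by rewrite /s2 /= /upd /= E9 Ex; case: ifP => _ /=; rewrite /upd /= ?addn1.
have -> : rmem s2 6 0 0 = if 1 <= rmem s1 6 0 0 + beta x then 0 else rmem s1 6 0 0 + beta x.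
  by rewrite /s2 /= /upd /= E9 Ex; case: ifP => _ /=; rewrite /upd /= ?E9 ?Ex.
by [].
Qed.

Lemma merge_leftoverP s : has_input s ->
  let s' := run merge_leftover s in
  narr s' 22 = (fun x => if narr s 22 x == (nmem s 37 0 0).+1 then nmem s 39 0 0
                         else narr s 22 x).
Proof.
move=> inp s'; set new := fun x => _.
pose I i s1 := [/\ nmem s1 37 0 0 = nmem s 37 0 0, nmem s1 39 0 0 = nmem s 39 0 0 &
  forall x, narr s1 22 x = if (rk x < i)%N then new x else narr s 22 x].
suff [_ _ h] : I #|X| s' by apply: funext => x; rewrite h rk_lt.
apply: for_ind => //.
move=> x s1 inp1 E9 [F37 F39 F22].
split; try by rewrite nset_other // run_nframe.
have old : narr s1 22 x = narr s 22 x by rewrite F22 ltnn.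
have bE : beval s1 (BNeq (ncell 22 (nvar 9)) new_label) =
    (narr s 22 x == (nmem s 37 0 0).+1).
  by rewrite /= E9 F37 addn1 -old eqn_leq.
rewrite run_when bE; apply: (rk_lt_step F22).
  by rewrite /new; case: ifP => _ //; rewrite /narr /= /upd /= E9 eqxx.
by move=> y /rk_at ne; case: ifP => // _; rewrite /narr /= /upd /= E9 ne.
Qed.

Lemma bins_phaseP lam P kmax tau s : has_input s ->
  dual_inv dist lam P kmax #|X| tau (rarr s 2) (narr s 20) (coreb s) ->
  narr s 22 = (fun=> 0%N) ->
  let s' := run bins_phase s in
  bins_inv dist lam (rarr s 2) (narr s 20) (coreb s) #|X| (nmem s' 37 0 0) (narr s' 22).
Proof.
move=> inp dinv E22 s'.
set beta := rarr s 2 in dinv *; set home := narr s 20 in dinv *.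
set core := coreb s in dinv *.
have hb x : (0 < home x)%N -> 0 <= beta x <= 1.
  move=> hx; have xf := home_frozen dinv hx.
  by rewrite xf andbT; case/andP: (dual_frozen dinv xf).
rewrite /s' /bins_phase run_seq; set s0 := run (setn _ _) s; set p := LFor 10 _.
pose I h s1 := [/\ narr s1 20 = home, narr s1 21 = narr s 21, rarr s1 2 = beta &
  bins_inv dist lam beta home core h (nmem s1 37 0 0) (narr s1 22)].
suff [] : I #|X| (run p s0) by [].
apply: for_ind => //; first exact: run_input.
  by split=> //; rewrite [narr _ 22]E22; apply: bins_init.
move=> x s1 inp1 E10 [F20 F21 F2 binv].
have C1 : coreb s1 = core by rewrite /coreb F21.
split; first by rewrite -F20; apply: funext => y; rewrite /narr nset_other // run_nframe.
- by rewrite -F21; apply: funext => y; rewrite /narr nset_other // run_nframe.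
- by rewrite -F2 -[LHS]/(rarr (run _ s1) 2) rarr_frame.
rewrite !run_seq; set s2 := run label_core s1; set s3 := run label_pool s2.
set s4 := run merge_leftover s3.
have inp2 : has_input s2 by apply: run_input.
have inp3 : has_input s3 by apply: run_input.
have [A1 A2 A3] := label_coreP inp1 E10; rewrite -/s2 F20 C1 in A1 A2 A3.
have G20 : narr s2 20 = home by rewrite -F20 narr_frame.
have G2 : rarr s2 2 = beta by rewrite -F2 rarr_frame.
have C2 : coreb s2 = core by rewrite -C1; apply: funext => y; rewrite /coreb narr_frame.
have G10 : nmem s2 10 0 0 = rk x by rewrite run_nframe.
set K := nmem s1 37 0 0 in A1 A2 A3 binv; set lab := narr s1 22 in A1 binv.
set K1 := if _ then _ else _ in A2 A3.
have labK y : (lab y <= K)%N.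
  have [/(bins_in binv)/andP[]//|/(bins_out binv) ->] := boolP (0 < home y <= rk x)%N; by [].
have le1 y : (narr s2 22 y <= nmem s2 37 0 0)%N.
  rewrite A1 A2 /open_label /K1; case: ifP => yC.
    by case: eqP => // E; rewrite E inE in yC.
  by apply: leq_trans (labK y) _; case: ifP.
have pinv := label_poolP inp2 G10 G2 G20 le1 hb; rewrite -/s3 C2 A1 A2 in pinv.
have := bins_close dist_metric dinv binv rk_lt pinv.
have M := merge_leftoverP inp3; rewrite -/s4 in M.
have -> : nmem (nset s4 10 0 0 (rk x).+1) 37 0 0 = nmem s3 37 0 0.
  by rewrite nset_other // run_nframe.
have -> : narr (nset s4 10 0 0 (rk x).+1) 22 = narr s4 22 by [].
have A39 : nmem s3 39 0 0 = K1 by rewrite run_nframe.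
by rewrite M A39.
Qed.

Lemma count_labelP s x : has_input s -> nmem s 9 0 0 = rk x ->
  nmem (run count_label s) 40 0 0 = #|label_set (narr s 22) (narr s 22 x)|.
Proof.
move=> inp E9; rewrite /count_label run_seq; set s0 := run (setn _ _) s; set p := LFor 11 _.
set lab := narr s 22.
pose I i s1 := [/\ narr s1 22 = lab, nmem s1 9 0 0 = rk x &
  nmem s1 40 0 0 = (\sum_(y | rk y < i) (lab y == lab x))%N].
suff [_ _ ->] : I #|X| (run p s0).
  rewrite big_rk_all -sum1_card [RHS]big_mkcond; apply: eq_bigr => y _.
  by rewrite inE; case: (_ == _).
apply: for_ind => //; first exact: run_input.
  by split=> //; rewrite big_rk0.
move=> y s1 inp1 E11 [F22 F9 G40]; rewrite /I big_rk_step -G40.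
have bE : beval s1 (BNeq (ncell 22 (nvar 11)) (ncell 22 (nvar 9))) = (lab y == lab x).
  have Ev v : nmem s1 22 (rk v) 0 = lab v by rewrite -F22.
  by rewrite /= E11 F9 !Ev eqn_leq.
rewrite run_when bE; case: (_ == _).
  by split; [exact: F22| |].
by split; [exact: F22| |rewrite /= addn0].
Qed.

(** A point that passes the price test is refused only when n' points have already been taken, and
    the count never decreases; hence the final alternative. *)
Lemma trim_phaseP s : has_input s ->
  (forall x, (0 < narr s 20 x)%N -> (0 < narr s 22 x)%N) ->
  let s' := run trim_phase s in
  let kp x := keep eps (rarr s 2) (coreb s) #|label_set (narr s 22) (narr s 22 x)| x in
  let res := narr s' 24 in
  [/\ forall x, res x != 0%N -> [/\ res x = narr s 22 x, (0 < narr s 20 x)%N & kp x],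
      (#|[set x | res x != 0%N]%SET| <= n')%N &
      (n' <= #|[set x | res x != 0%N]%SET|)%N \/
       (forall x, (0 < narr s 20 x)%N -> kp x -> res x = narr s 22 x)].
Proof.
move=> inp lab0 s' kp res.
rewrite /res /s' /trim_phase run_seq; set s0 := run (setn _ _) s; set p := LFor 9 _.
pose I i s1 := [/\ narr s1 20 = narr s 20, narr s1 21 = narr s 21, narr s1 22 = narr s 22,
   rarr s1 2 = rarr s 2 &
  [/\ nmem s1 41 0 0 = (\sum_(x | rk x < i) (narr s1 24 x != 0))%N, (nmem s1 41 0 0 <= n')%N,
    forall x, (rk x < i)%N -> narr s1 24 x != 0%N ->
      [/\ narr s1 24 x = narr s 22 x, (0 < narr s 20 x)%N & kp x] &
    (n' <= nmem s1 41 0 0)%N \/ forall x, (rk x < i)%N -> (0 < narr s 20 x)%N -> kp x ->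
      narr s1 24 x = narr s 22 x]].
suff [_ _ _ _ [h1 h2 h3 h4]] : I #|X| (run p s0).
  have cE : #|[set x | narr (run p s0) 24 x != 0%N]%SET| = nmem (run p s0) 41 0 0.
    rewrite h1 big_rk_all -sum1_card big_mkcond; apply: eq_bigr => x _.
    by rewrite inE; case: (_ == _).
  rewrite cE; split=> //; first by move=> x; apply: h3; apply: rk_lt.
  by case: h4 => [|h4]; [left|right=> x; apply: h4; apply: rk_lt].
apply: for_ind => //; first exact: run_input.
  split=> //; split=> //; first by rewrite big_rk0.
  by right.
move=> x s1 inp1 E9 [F20 F21 F22 F2 [h1 h2 h3 h4]].
split; try by [rewrite -F20; apply: funext => y; rewrite /narr nset_other // run_nframe
  |rewrite -F21; apply: funext => y; rewrite /narr nset_other // run_nframe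
  |rewrite -F22; apply: funext => y; rewrite /narr nset_other // run_nframe
  |rewrite -F2 -[LHS]/(rarr (run _ s1) 2) rarr_frame].
rewrite run_seq; set s2 := run count_label s1.
have G40 : nmem s2 40 0 0 = #|label_set (narr s 22) (narr s 22 x)|.
  by rewrite -F22; apply: count_labelP.
have inp2 : has_input s2 by apply: run_input.
have G9 : nmem s2 9 0 0 = rk x by rewrite run_nframe.
have G41 : nmem s2 41 0 0 = nmem s1 41 0 0 by rewrite run_nframe.
have G20 : nmem s2 20 (rk x) 0 = narr s 20 x by rewrite run_nframe // -F20.
have G22 : nmem s2 22 (rk x) 0 = narr s 22 x by rewrite run_nframe // -F22.
have G2 : rmem s2 2 (rk x) 0 = rarr s 2 x by rewrite run_rframe // -F2.
have G24 y : nmem s2 24 (rk y) 0 = narr s1 24 y by rewrite run_nframe.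
have Gc : coreb s2 x = coreb s x by rewrite /coreb narr_frame // F21.
have bE : beval s2 keep_test =
    [&& (0 < narr s 20 x)%N, kp x & (nmem s1 41 0 0 < n')%N].
  rewrite /keep_test !beval_and; congr [&& _, _ & _].
  - by rewrite /= G9 G20.
  - rewrite beval_or (is_coreP G9) Gc /kp /keep; congr (_ || _).
    by rewrite /= G9 G2 (input_eps inp2) G40.
  - by rewrite /= G41 (input_n' inp2) ltnNge.
rewrite run_if bE; case: ifP => [/and3P[hx kx lt]|hn].
  set s3 := nset _ _ _ _ _.
  have S41 : nmem s3 41 0 0 = (nmem s1 41 0 0).+1.
    by rewrite /s3 /= /upd /= G41 addn1.
  have Sx : narr s3 24 x = narr s 22 x.
    by rewrite /s3 /narr /= /upd /= G9 eqxx.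
  have Sy y : y != x -> narr s3 24 y = narr s1 24 y.
    by move=> /rk_at ne; rewrite /s3 /narr /= /upd /= G9 ne; apply: G24.
  have Slt y : (rk y < rk x)%N -> narr s3 24 y = narr s1 24 y.
    by move=> ltx; apply: Sy; apply: contraTneq ltx => ->; rewrite ltnn.
  split.
  - rewrite S41 h1 big_rk_step Sx -lt0n lab0 // -[RHS]/(_ + 1)%N addn1; congr S.
    by apply: eq_bigr => y ltx; rewrite Slt.
  - by rewrite S41.
  - move=> y; rewrite ltnS leq_eqVlt => /orP[/eqP/rk_inj ->|ltx]; first by rewrite Sx.
    by rewrite Slt //; apply: h3.
  - case: h4 => [|h4]; first by rewrite leqNgt lt.
    right=> y; rewrite ltnS leq_eqVlt => /orP[/eqP/rk_inj ->|ltx] //.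
    by rewrite Slt //; apply: h4.
set s3 := nset _ _ _ _ _.
have S41 : nmem s3 41 0 0 = nmem s1 41 0 0 by rewrite /s3 /= /upd /= G41.
have Sx : narr s3 24 x = 0%N by rewrite /s3 /narr /= /upd /= G9 eqxx.
have Sy y : y != x -> narr s3 24 y = narr s1 24 y.
  by move=> /rk_at ne; rewrite /s3 /narr /= /upd /= G9 ne; apply: G24.
have Slt y : (rk y < rk x)%N -> narr s3 24 y = narr s1 24 y.
  by move=> ltx; apply: Sy; apply: contraTneq ltx => ->; rewrite ltnn.
split.
- rewrite S41 h1 big_rk_step Sx eqxx -[RHS]/(_ + 0)%N addn0.
  by apply: eq_bigr => y ltx; rewrite Slt.
- by rewrite S41.
- move=> y; rewrite ltnS leq_eqVlt => /orP[/eqP/rk_inj ->|ltx]; first by rewrite Sx.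
  by rewrite Slt //; apply: h3.
- rewrite S41; have [le|lt] := leqP n' (nmem s1 41 0 0); first by left.
  case: h4 => [|h4]; first by rewrite leqNgt lt.
  right=> y; rewrite ltnS leq_eqVlt => /orP[/eqP/rk_inj ->|ltx].
    by move=> hx kx; rewrite hx kx lt in hn.
  by rewrite Slt //; apply: h4.
Qed.

Definition solution_ok s : Prop :=
  (0 < nmem s 42 0 0)%N -> 0 <= rmem s 7 0 0 /\
    good_labels dist k n' eps (rmem s 7 0 0) (narr s 1).

(** The recorded scale never increases, and it ends no larger than any adequate scale tried in
    [D]. *)
Definition solved (D : nat -> X -> X -> Prop) s s' : Prop :=
  [/\ solution_ok s -> solution_ok s',
    (0 < nmem s 42 0 0)%N -> (0 < nmem s' 42 0 0)%N /\ rmem s' 7 0 0 <= rmem s 7 0 0 &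
    forall m z c, D m z c -> let lam := m.+1%:R ^+ 2 * dist z c in
      adequate dist k n' (eps / 8) lam ->
      (0 < nmem s' 42 0 0)%N /\ rmem s' 7 0 0 <= lam].

(** At most k labels suffice for the result to be good, by [labels_good]. Adequacy enters through
    [bins_count]: it forces the number of labels below k + 1, so the scale is accepted unless one at
    least as small is already recorded. *)
Lemma solve_lambdaP s m z c : has_input s ->
  nmem s 2 0 0 = m -> nmem s 3 0 0 = rk z -> nmem s 4 0 0 = rk c ->
  solved (fun m1 z1 c1 => [/\ m1 = m, z1 = z & c1 = c]) s (run solve_lambda s).
Proof.
move=> inp E2 E3 E4; rewrite /solve_lambda !run_seq.
set s0 := run (setr _ _) s; set lam := m.+1%:R ^+ 2 * dist z c.
have inp0 : has_input s0 by apply: run_input.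
have L0 : rmem s0 3 0 0 = lam.
  by rewrite /s0 /= /upd /= E2 E3 E4 (input_dist inp) addn1 -expr2.
have lam0 : 0 <= lam by rewrite mulr_ge0 ?exprn_ge0 //; case: dist_metric.
have [st enough E22] := dual_phaseP lam0 inp0 L0.
set s1 := run dual_phase s0 in st enough E22 *.
case: st => L1 [tau dinv] _ epsF.
have inp1 : has_input s1 by apply: run_input.
have binv := bins_phaseP inp1 dinv E22.
set s2 := run bins_phase s1 in binv *.
have inp2 : has_input s2 by apply: run_input.
have G20 : narr s2 20 = narr s1 20 by rewrite narr_frame.
have G2 : rarr s2 2 = rarr s1 2 by rewrite rarr_frame.
have Gc : coreb s2 = coreb s1 by apply: funext => x; rewrite /coreb narr_frame.
have lab0 x : (0 < narr s2 20 x)%N -> (0 < narr s2 22 x)%N.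
  rewrite G20 => hx; have xf := home_frozen dinv hx.
  by have /andP[] := bins_in binv (dual_home dinv xf).
have [r1 r2 r3] := trim_phaseP inp2 lab0.
set s3 := run trim_phase s2 in r1 r2 r3 *.
rewrite G20 G2 Gc in r1 r3.
have inp3 : has_input s3 by apply: run_input.
have K3 : nmem s3 37 0 0 = nmem s2 37 0 0 by rewrite run_nframe.
have L3 : rmem s3 3 0 0 = lam by rewrite run_rframe // run_rframe.
have F42 : nmem s3 42 0 0 = nmem s 42 0 0 by rewrite !run_nframe.
have F7 : rmem s3 7 0 0 = rmem s 7 0 0 by rewrite !run_rframe.
have F1 : narr s3 1 = narr s 1 by rewrite !narr_frame.
have good : (nmem s2 37 0 0 <= k)%N -> good_labels dist k n' eps lam (narr s3 24).
  by move=> leK; apply: (labels_good dist_metric dinv) binv leK r1 r2 r3.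
have adeq : adequate dist k n' (eps / 8) lam -> (nmem s2 37 0 0 <= k)%N.
  by move=> /(bins_count dinv binv); rewrite ltr_nat ltnS.
rewrite /record_phase run_when.
have -> : beval s3 (BAnd (BNle (nvar 37) (ncell 0 (NConst 1)))
     (BNot (BAnd (BNle (NConst 1) (nvar 42)) (BRle (rvar 7) (rvar 3))))) =
    (nmem s2 37 0 0 <= k)%N && ~~ ((0 < nmem s 42 0 0)%N && (rmem s 7 0 0 <= lam)).
  by rewrite /= K3 (input_k inp3) F42 F7 L3.
case: ifP => [/andP[leK better]|hn]; last first.
  split.
  - by rewrite /solution_ok F42 F7 F1.
  - by rewrite F42 F7.
  - move=> m1 z1 c1 [-> -> ->] /= /adeq leK; rewrite F42 F7.
    by move: hn; rewrite leK => /negbFE /andP.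
rewrite !run_seq; set s4 := run (setr _ _) _.
have inp4 : has_input s4 by apply: run_input => //; apply: run_input.
set p := LFor 9 _; set s5 := run p s4.
have H42 : nmem s5 42 0 0 = 1%N by rewrite run_nframe.
have H7 : rmem s5 7 0 0 = lam by rewrite run_rframe // -L3.
have H1 : narr s5 1 = narr s3 24.
  pose I i s6 := (forall x, narr s6 24 x = narr s3 24 x) /\
     forall x, (rk x < i)%N -> narr s6 1 x = narr s3 24 x.
  suff [_ h] : I #|X| s5 by apply: funext => x; apply: h; apply: rk_lt.
  apply: for_ind => //.
  move=> x s6 inp6 E9 [e1 e2]; split=> y; first exact: e1.
  rewrite ltnS leq_eqVlt => /orP[/eqP/rk_inj ->|lt].
    by rewrite /narr /= /upd /= E9 eqxx; apply: e1.
  have ne : (rk y == rk x) = false by rewrite ltn_eqF.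
  by rewrite /narr /= /upd /= E9 ne; apply: e2.
split.
- by move=> _ _; rewrite H7 H1; split=> //; apply: good.
- by move=> h42; rewrite H42 H7; split=> //; move: better; rewrite h42 /= -ltNge => /ltW.
- by move=> m1 z1 c1 [-> -> ->] /= _; rewrite H42 H7.
Qed.

Lemma min_sum_algorithmP s : has_input s ->
  solved (fun m _ _ => (m < #|X|)%N) s (run min_sum_algorithm s).
Proof.
move=> inp.
(* Here [s3] is [s3'] up to the update of a loop counter. *)
have trans (D1 D2 D3 : nat -> X -> X -> Prop) s1 s2 s3 s3' :
    (forall m z c, D3 m z c -> D1 m z c \/ D2 m z c) ->
    solved D1 s1 s2 -> solved D2 s2 s3' ->
    (forall i j, nmem s3 1 i j = nmem s3' 1 i j) ->
    (forall i j, nmem s3 42 i j = nmem s3' 42 i j) -> rmem s3 = rmem s3' ->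
    solved D3 s1 s3.
  move=> hD [h1 h2 h3] [g1 g2 g3] e1 e2 e3.
  have e4 : narr s3 1 = narr s3' 1 by apply: funext => x; apply: e1.
  split; rewrite ?/solution_ok ?e2 ?e3 ?e4.
  - by move=> /h1/g1.
  - by move=> /h2[/g2[h4 h5] h6]; split=> //; apply: le_trans h5 h6.
  - move=> m z c /hD[d|d] ad; last exact: (g3 _ _ _ d ad).
    by have [/g2[h4 h5] h6] := h3 _ _ _ d ad; split=> //; apply: le_trans h5 h6.
have H4 s1 m z : has_input s1 -> nmem s1 2 0 0 = m -> nmem s1 3 0 0 = rk z ->
    solved (fun m1 z1 c1 => m1 = m /\ z1 = z) s1 (run (LFor 4 solve_lambda) s1).
  move=> inp1 E2 E3.
  pose I i s2 := [/\ nmem s2 2 0 0 = m, nmem s2 3 0 0 = rk z &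
    solved (fun m1 z1 c1 => [/\ m1 = m, z1 = z & (rk c1 < i)%N]) s1 s2].
  suff [_ _ [h1 h2 h3]] : I #|X| (run (LFor 4 solve_lambda) s1).
    by split=> // m1 z1 c1 [-> ->]; apply: h3; split=> //; apply: rk_lt.
  apply: for_ind => //; first by split=> //; split=> // m1 z1 c1 [].
  move=> c s2 inp2 E4 [F2 F3 sol].
  split; try by rewrite nset_other // run_nframe.
  apply: (trans _ _ _ _ _ _ _ _ sol (solve_lambdaP inp2 F2 F3 E4)) => //.
  move=> m1 z1 c1 [-> ->]; rewrite ltnS leq_eqVlt => /orP[/eqP/rk_inj ->|lt].
    by right.
  by left.
have H3 s1 m : has_input s1 -> nmem s1 2 0 0 = m ->
    solved (fun m1 z1 c1 => m1 = m) s1 (run (LFor 3 (LFor 4 solve_lambda)) s1).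
  move=> inp1 E2.
  pose I i s2 := nmem s2 2 0 0 = m /\
    solved (fun m1 z1 c1 => m1 = m /\ (rk z1 < i)%N) s1 s2.
  suff [_ [h1 h2 h3]] : I #|X| (run (LFor 3 (LFor 4 solve_lambda)) s1).
    by split=> // m1 z1 c1 ->; apply: h3; split=> //; apply: rk_lt.
  apply: for_ind => //; first by split=> //; split=> // m1 z1 c1 [].
  move=> z s2 inp2 E3 [F2 sol].
  split; first by rewrite nset_other // run_nframe.
  apply: (trans _ _ _ _ _ _ _ _ sol (H4 _ _ _ inp2 F2 E3)) => //.
  move=> m1 z1 c1 [->]; rewrite ltnS leq_eqVlt => /orP[/eqP/rk_inj ->|lt].
    by right.
  by left.
pose I i s2 := solved (fun m1 z1 c1 => (m1 < i)%N) s s2.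
suff : I #|X| (run min_sum_algorithm s) by [].
apply: for_ind => //.
move=> x s2 inp2 E2 sol.
apply: (trans _ _ _ _ _ _ _ _ sol (H3 _ _ inp2 E2)) => //.
move=> m1 z1 c1; rewrite ltnS leq_eqVlt => /orP[/eqP ->|lt].
  by right.
by left.
Qed.

Lemma min_sum_algorithm_good s : has_input s -> nmem s 42 0 0 = 0%N ->
  exists lam, [/\ 0 <= lam, lam * (eps / 8) ^+ 2 * k%:R <= 8 * opt dist n' k &
    good_labels dist k n' eps lam (narr (run min_sum_algorithm s) 1)].
Proof.
move=> inp E42; have [h1 _ h3] := min_sum_algorithmP inp.
have d0 : 0 < eps / 8 by rewrite divr_gt0.
have [m [z [c [lt ad le]]]] := exists_adequate dist_metric k_gt0 n'_bounds d0.
have [g1 g2] := h3 m z c lt ad.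
have ok : solution_ok s by rewrite /solution_ok E42.
have [l0 good] := h1 ok g1.
exists (rmem (run min_sum_algorithm s) 7 0 0); split=> //.
apply: le_trans le; rewrite -mulrA; apply: ler_wpM2r => //.
by rewrite mulr_ge0 ?exprn_ge0 // ltW.
Qed.
End Correctness.

(** On a finite space with a non-zero distance, the supremum is at least the infimum, which is
    positive. Otherwise the ratio is 0 and [ln] of 0 is 0 by convention. *)
Lemma ln_aspect_ratio_ge0 (R : realType) (X : finType) (dist : X -> X -> R) :
  is_metric dist -> 0 <= ln (aspect_ratio dist).
Proof.
case=> d0 _ _ _; rewrite /aspect_ratio; set S := (fun r : R => _).
have [[u0 Pu0]|none] := pselect (exists u : X * X, dist u.1 u.2 != 0); last first.
  have -> : S = classical_sets.set0.
    by rewrite -subset0 => r [x [y [ne _]]]; apply: none; exists (x, y).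
  by rewrite sup0 mul0r ln0.
have [u Pu minu] := @arg_minP _ R _ u0 (fun u => dist u.1 u.2 != 0) (fun u => dist u.1 u.2) Pu0.
have [v Pv maxv] := @arg_maxP _ R _ u0 (fun u => dist u.1 u.2 != 0) (fun u => dist u.1 u.2) Pu0.
have lbS : forall r, S r -> dist u.1 u.2 <= r.
  by move=> r [x [y [ne ->]]]; apply: (minu (x, y)).
have ubS : has_ubound S.
  by exists (dist v.1 v.2) => r [x [y [ne ->]]]; apply: (maxv (x, y)).
have Su : S (dist u.1 u.2) by exists u.1, u.2.
have inf_gt0 : 0 < inf S.
  apply: lt_le_trans (_ : dist u.1 u.2 <= _); first by rewrite lt_neqAle eq_sym Pu d0.
  by apply: lb_le_inf; [exists (dist u.1 u.2)|].
apply: ln_ge0; rewrite ler_pdivlMr // mul1r.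
apply: le_trans (_ : dist u.1 u.2 <= _); last exact: ub_le_sup.
by apply: ge_inf => //; exists (dist u.1 u.2).
Qed.

Theorem theorem9 (R : realType) :
  exists (alg : program) (C : R) (a b : nat),
    forall (X : finType) (dist : X -> X -> R) (k n' : nat) (eps : R),
      is_metric dist ->
      (0 < k)%N ->
      (1 <= n' <= #|X|)%N ->
      0 < eps ->
      exists (s : state R) (t : nat),
        exec alg (input_state dist k n' eps) s t /\
        t%:R <= a%:R * poly_base dist eps ^+ b /\
        is_clustering (out_points X s) (@out_clusters R X s k) /\
        (1 - eps) * n'%:R <= #|out_points X s|%:R :> R /\
        (#|out_points X s| <= n')%N /\
        total_cost dist (@out_clusters R X s k) <=
          C * (1 / eps ^+ 3) * opt dist n' k.
Proof.
have [a [b tb]] := time_bound_poly min_sum_algorithm.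
(* The k clusters cost at most 56 lam / eps each, and lam (eps / 8)^2 k <= 8 opt, so the constant is
   56 * 64 * 8. *)
exists (compile min_sum_algorithm), (56 * 512), a, b => X dist k n' eps dm k0 n0 e0.
set s0 := input_state dist k n' eps.
have [t ex tt] := exec_compile s0 (p := min_sum_algorithm) isT isT.
exists (run min_sum_algorithm s0), t; split=> //.
have inp : has_input dist k n' eps s0.
  by split=> //= x y; rewrite /dist_matrix /rk !valK !enum_rankK.
have [lam [lam0 leopt [h1 h2 h3 h4]]] := min_sum_algorithm_good dm k0 n0 e0 inp erefl.
set s := run min_sum_algorithm s0 in h1 h2 h3 h4 *.
split.
  (* Both logarithmic terms are nonnegative, so a bound polynomial in n + 1 is one in
     [poly_base]. *)
  have base : #|X|.+1%:R <= poly_base dist eps.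
    rewrite /poly_base -natr1; have := ln_aspect_ratio_ge0 dm.
    have : 0 <= Num.max 0 (ln eps^-1) by rewrite le_max lexx.
    lra.
  apply: le_trans (_ : (a * #|X|.+1 ^ b)%:R <= _).
    by rewrite ler_nat; apply: leq_trans tt (tb _).
  rewrite natrM natrX; apply: ler_wpM2l => //.
  by rewrite lerXn2r ?nnegrE // (le_trans _ base).
split; [split|split; [|split]] => //.
- move=> i j ij; rewrite -finset.setI_eq0; apply/eqP/setP => x; rewrite !inE.
  apply/negbTE/negP => /andP[/eqP -> /eqP [E]].
  by move/eqP: ij; apply; apply: ord_inj.
- apply/setP => x; rewrite !inE; apply/bigcupP/idP => [[i _]|nz].
    by rewrite inE => /eqP ->.
  have lek := h1 x; rewrite /narr -/(out_label s x) in lek.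
  have ltk : ((out_label s x).-1 < k)%N by rewrite prednK // lt0n.
  by exists (Ordinal ltk) => //; rewrite inE /= prednK // lt0n.
have -> : total_cost dist (@out_clusters R X s k) =
    \sum_(i < k) cost dist (label_set (narr s 1) i.+1) by [].
apply: le_trans h4 _.
have -> : (56 * 512) * (1 / eps ^+ 3) * opt dist n' k =
    (56 / eps) * (64 / eps ^+ 2) * (8 * opt dist n' k).
  by field; rewrite gt_eqF.
have -> : k%:R * (56 * lam / eps) =
    (56 / eps) * (64 / eps ^+ 2) * (lam * (eps / 8) ^+ 2 * k%:R).
  by field; rewrite gt_eqF.
by rewrite ler_wpM2l // mulr_ge0 // divr_ge0 ?exprn_ge0 // ltW.
Qed.
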